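(* Let $m\ge1$, $\boldsymbol n\in\mathbb N^m$, let $\mathcal C\subseteq\mathcal P^{(m)}$ be an $\boldsymbol n$-graded rigid category of spatial partitions and let $z\in\{\circ,\bullet\}^*$ with $d:=|z|\ge1$. Put $\mathcal D:=\mathrm{Flat}_{m,z}^{-1}(\mathcal C)=\{p\in\mathcal P^{(md)}:\mathrm{Flat}_{m,z}(p)\in\mathcal C\}$ and let $\boldsymbol n\cdots\boldsymbol n\in\mathbb N^{md}$ be the $d$-fold repetition of $\boldsymbol n$. Then $G_{\boldsymbol n}(\mathcal C)^z$ is equivalent to $G_{\boldsymbol n\cdots\boldsymbol n}(\mathcal D)$.
   Context: Colours: $\{\circ,\bullet\}^*$ is the free monoid of finite words in two colours with empty word $1$; $|x|$ is the length and $x_i$ the $i$-th letter of $x$; $x\mapsto\overline x$ is the anti-homomorphism with $\overline\circ=\bullet$, $\overline\bullet=\circ$. Spatial partitions: for $m\ge1$, $\mathcal P^{(m)}(x,y)$ is the set of set partitions (into blocks) of $\{1,\dots,|x|+|y|\}\times\{1,\dots,m\}$; points $(i,j)$ with $i\le|x|$ are upper points of colour $x_i$, points $(|x|+i,j)$ are lower points of colour $y_i$, and $j$ is the level. $\mathcal P^{(m)}=\bigcup_{x,y}\mathcal P^{(m)}(x,y)$. Tensor product: place partitions side by side. Involution $p^*\in\mathcal P^{(m)}(y,x)$: swap upper and lower points. Composition $pq\in\mathcal P^{(m)}(x,z)$ of $p\in\mathcal P^{(m)}(y,z)$, $q\in\mathcal P^{(m)}(x,y)$: identify each lower point of $q$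 with the corresponding upper point of $p$, merge blocks sharing identified points, delete the identified points and any resulting empty blocks. $\mathrm{id}_x\in\mathcal P^{(m)}(x,x)$ has blocks $\{(i,j),(|x|+i,j)\}$. A category of spatial partitions on $m$ levels is a subset $\mathcal C\subseteq\mathcal P^{(m)}$ closed under composition, tensor product and involution and containing $\mathrm{id}_\circ,\mathrm{id}_\bullet$; $\mathcal C(x,y)=\mathcal C\cap\mathcal P^{(m)}(x,y)$. It is rigid if there are $r\in\mathcal C(1,\circ\bullet)$, $s\in\mathcal C(1,\bullet\circ)$ with $(r^*\otimes\mathrm{id}_\circ)(\mathrm{id}_\circ\otimes s)=\mathrm{id}_\circ$ and $(s^*\otimes\mathrm{id}_\bullet)(\mathrm{id}_\bullet\otimes r)=\mathrm{id}_\bullet$. For $\boldsymbol n=(n_1,\dots,n_m)\in\mathbb N^m$, $p$ is $\boldsymbol n$-graded if $n_k=n_\ell$ whenever points $(i,k),(j,\ell)$ lie in one block; a category is $\boldsymbol n$-graded if all its elements are. Flattening: for $m\ge1$ and $z\in\{\circ,\bullet\}^*$ with $d=|z|\ge1$, $\mathrm{Flat}_{m,z}:\mathcal P^{(md)}\to\mathcal P^{(m)}$ acts on words as the monoid homomorphism with $\circ\mapsto z$, $\bullet\mapsto\overline z$, and sends $p\in\mathcal P^{(md)}(x,y)$ to the partition in $\mathcal P^{(m)}(\mathrm{Flat}_{m,z}(x),\mathrm{Flat}_{m,z}(y))$ whose blocks are the images of the blocks of $p$ under the bijection $\{1,\dots,|x|+|y|\}\times\{1,\dots,md\}\to\{1,\dots,(|x|+|y|)d\}\times\{1,\dots,m\}$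 given, for $1\le j\le m$, $0\le c<d$, by $(i,j+cm)\mapsto((i-1)d+c+1,j)$ if $(xy)_i=\circ$ and $(i,j+cm)\mapsto(id-c,j)$ if $(xy)_i=\bullet$. ($\mathrm{Flat}_{m,z}^{-1}(\mathcal C)$ is an $(\boldsymbol n\cdots\boldsymbol n)$-graded rigid category.) Quantum groups: for a finite-dimensional Hilbert space $V$ with conjugate $\overline V$, put $V^\circ=V$, $V^\bullet=\overline V$, $V^{\otimes x}=V^{x_1}\otimes\cdots\otimes V^{x_{|x|}}$ ($\mathbb C$ if $x=1$); for an operator $T$, $\overline T(\overline v)=\overline{T(v)}$, $T^\circ=T$, $T^\bullet=\overline T$, $T^{\otimes x}=T^{x_1}\otimes\cdots\otimes T^{x_{|x|}}$. Elements $u\in B(V)\otimes A$ ($A$ a unital $C^*$-algebra) are $A$-valued matrices $(u^i_j)$ in an orthonormal basis; $\overline u\in B(\overline V)\otimes A$ has entries $(u^i_j)^*$; $u\top v$ on $V\otimes W$ has entries $u^{i_1}_{j_1}v^{i_2}_{j_2}$. A compact matrix quantum group is $G=(C(G),u)$ with $C(G)$ a unital $C^*$-algebra generated by the entries of $u\in B(V)\otimes C(G)$, $u$ unitary, $\overline u$ invertible, and a $*$-homomorphism $\Delta:C(G)\to C(G)\otimes C(G)$ with $\Delta(u^i_j)=\sum_k u^i_k\otimes u^k_j$; $\mathcal O(G)$ is the $*$-algebra generated by the entries. A representation is an invertible $v\in B(W)\otimes C(G)$ with $\Delta(v^i_j)=\sum_k v^i_k\otimes v^k_j$; $\mathrm{Hom}(v,w)=\{T: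 Tv=wT\}$. Given $u^\circ=u$ and a unitary representation $u^\bullet$ on $\overline V$, $u^x=u^{x_1}\top\cdots\top u^{x_{|x|}}$, $u^1=1$. $u^\bullet$ is conjugate to $u^\circ$ if there are $R\in\mathrm{Hom}(1,u^\circ\top u^\bullet)$, $S\in\mathrm{Hom}(1,u^\bullet\top u^\circ)$ with $(R^*\otimes\mathrm{id}_V)(\mathrm{id}_V\otimes S)=\mathrm{id}_V$, $(S^*\otimes\mathrm{id}_{\overline V})(\mathrm{id}_{\overline V}\otimes R)=\mathrm{id}_{\overline V}$. Linear maps: $[\boldsymbol n]=\prod_k\{1,\dots,n_k\}$, $\mathbb C^{\boldsymbol n}=\mathbb C^{n_1}\otimes\cdots\otimes\mathbb C^{n_m}$ with basis $e_{\boldsymbol i}$, $\boldsymbol i\in[\boldsymbol n]$. For $\boldsymbol n$-graded $p\in\mathcal P^{(m)}(x,y)$, $T_p^{(\boldsymbol n)}:(\mathbb C^{\boldsymbol n})^{\otimes x}\to(\mathbb C^{\boldsymbol n})^{\otimes y}$ has, in the canonical bases, matrix coefficient (input $\boldsymbol j_1,\dots,\boldsymbol j_{|x|}$, output $\boldsymbol i_1,\dots,\boldsymbol i_{|y|}$) equal to $1$ if, labelling upper point $(k,\ell)$ by the $\ell$-th entry of $\boldsymbol j_k$ and lower point $(|x|+k,\ell)$ by the $\ell$-th entry of $\boldsymbol i_k$, labels are constant on every block, and $0$ otherwise. For an $\boldsymbol n$-graded rigid category $\mathcal C\subseteq\mathcal P^{(m)}$, $G_{\boldsymbol n}(\mathcal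 C)$ is the compact matrix quantum group with fundamental representation $u^\circ$ on $\mathbb C^{\boldsymbol n}$ and a unitary representation $u^\bullet$ on $\overline{\mathbb C^{\boldsymbol n}}$ such that $\mathrm{Hom}(u^x,u^y)=\mathrm{span}\{T_p^{(\boldsymbol n)}:p\in\mathcal C(x,y)\}$ for all $x,y$ (it exists by Woronowicz Tannaka–Krein duality, $\mathcal O(G)$ and $u^\bullet$ are uniquely determined, and $C(G)$ is taken to be the universal $C^*$-completion). Tensor powers: for a compact matrix quantum group $G$ with fundamental representation $u^\circ=u$ on $V$ and a chosen unitary representation $u^\bullet$ of $G$ on $\overline V$, and for $z\in\{\circ,\bullet\}^*$ with $|z|\ge1$, $G^z=(A,u^z)$, where $u^z=u^{z_1}\top\cdots\top u^{z_{|z|}}$ and $A\subseteq C(G)$ is the $C^*$-subalgebra generated by the entries of $u^z$; for $G=G_{\boldsymbol n}(\mathcal C)$ one uses its $u^\bullet$. Equivalence: compact matrix quantum groups $G$, $H$ with fundamental representations $u^\circ$ on $V$, $w^\circ$ on $W$ are equivalent if, for some unitary conjugate representations $u^\bullet$ on $\overline V$ and $w^\bullet$ on $\overline W$, there is a unitary $Q:V\to W$ with $\mathrm{Hom}(u^x,u^y)=(Q^{-1})^{\otimes y}\,\mathrm{Hom}(w^x,w^y)\,Q^{\otimes x}$ for all $x,y\in\{\circ,\bullet\}^*$. *)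

(* Defs.v *)
From HB Require Import structures.
From mathcomp Require Import all_boot all_order all_algebra.
From mathcomp Require Import complex reals.

Set Implicit Arguments.
Unset Strict Implicit.
Unset Printing Implicit Defensive.
Import Order.TTheory GRing.Theory Num.Theory.

(** * Coloured words *)

Inductive colour := White | Black.

Notation word := (seq colour).

Definition flip (c : colour) : colour := if c is White then Black else White.

Definition wbar (x : word) : word := rev (map flip x).

Definition letter (x : word) (k : 'I_(size x)) : colour := tnth (in_tuple x) k.

(** * Spatial partitions *)

(* The k-th upper (resp. lower) point on level l is (inl k, l)
   (resp. (inr k, l)); all positions and levels are counted from 0. *)
Definition point (m : nat) (x y : word) : finType :=
  (('I_(size x) + 'I_(size y)) * 'I_m)%type.

Record spart (m : nat) (x y : word) := SPart {
  blocks :> {set {set point m x y}};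
  blocksP : partition blocks [set: point m x y] }.

HB.instance Definition _ m x y := [isSub for @blocks m x y].
HB.instance Definition _ m x y := [Finite of spart m x y by <:].

(* Most operations on partitions are given by a labelling of the points of the
   result: two points are in the same block iff they have the same label. *)
Definition part_of_labels (m : nat) (x y : word) (T : eqType)
    (f : point m x y -> T) : spart m x y :=
  SPart (preim_partitionP f [set: point m x y]).

Definition pid (m : nat) (x : word) : spart m x x :=
  part_of_labels (fun a : point m x x =>
    (match a.1 with inl k => k | inr k => k end, a.2)).

Definition swap_point (m : nat) (x y : word) (a : point m y x) : point m x y :=
  (match a.1 with inl k => inr k | inr k => inl k end, a.2).

Definition pinv (m : nat) (x y : word) (p : spart m x y) : spart m y x :=
  part_of_labels (fun a => pblock p (swap_point a)).

Definition split_pos (x x' : word) (k : 'I_(size (x ++ x'))) :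
    'I_(size x) + 'I_(size x') :=
  split (cast_ord (size_cat x x') k).

Definition split_point (m : nat) (x x' y y' : word)
    (a : point m (x ++ x') (y ++ y')) : point m x y + point m x' y' :=
  match a.1 with
  | inl k => match split_pos k with
             | inl k1 => inl (inl k1, a.2) | inr k2 => inr (inl k2, a.2) end
  | inr k => match split_pos k with
             | inl k1 => inl (inr k1, a.2) | inr k2 => inr (inr k2, a.2) end
  end.

Definition ptensor (m : nat) (x x' y y' : word)
    (p : spart m x y) (p' : spart m x' y') : spart m (x ++ x') (y ++ y') :=
  part_of_labels (fun a : point m (x ++ x') (y ++ y') =>
    match split_point a return {set point m x y} + {set point m x' y'} with
    | inl b => inl (pblock p b)
    | inr b => inr (pblock p' b)
    end).

Section Composition.
Variables (m : nat) (x y z : word).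

(* Points of the diagram of p over q after the lower points of q have been
   identified with the upper points of p: upper, middle and lower points. *)
Definition glued_point : finType :=
  (('I_(size x) + 'I_(size y) + 'I_(size z)) * 'I_m)%type.

Definition in_top (a : point m x y) : glued_point :=
  (match a.1 with inl k => inl (inl k) | inr k => inl (inr k) end, a.2).

Definition in_bot (a : point m y z) : glued_point :=
  (match a.1 with inl k => inl (inr k) | inr k => inr k end, a.2).

Definition in_outer (a : point m x z) : glued_point :=
  (match a.1 with inl k => inl (inl k) | inr k => inr k end, a.2).

Definition glue (p : spart m y z) (q : spart m x y) : rel glued_point :=
  fun a b =>
    [exists B in blocks q, (a \in in_top @: B) && (b \in in_top @: B)]
 || [exists B in blocks p, (a \in in_bot @: B) && (b \in in_bot @: B)].

Definition pcomp (p : spart m y z) (q : spart m x y) : spart m x z :=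
  part_of_labels (fun a : point m x z =>
    [set b | connect (glue p q) (in_outer a) b]).

End Composition.

(* A subset of P^(m), as its family of components C(x, y). *)
Definition part_family (m : nat) := forall x y : word, {set spart m x y}.

Definition is_category (m : nat) (C : part_family m) : Prop :=
  [/\ forall x y z (p : spart m y z) (q : spart m x y),
        p \in C y z -> q \in C x y -> pcomp p q \in C x z,
      forall x x' y y' (p : spart m x y) (p' : spart m x' y'),
        p \in C x y -> p' \in C x' y' ->
        ptensor p p' \in C (x ++ x') (y ++ y'),
      forall x y (p : spart m x y), p \in C x y -> pinv p \in C y x,
      pid m [:: White] \in C [:: White] [:: White]
    & pid m [:: Black] \in C [:: Black] [:: Black] ].

Definition is_rigid (m : nat) (C : part_family m) : Prop :=
  exists (r : spart m [::] [:: White; Black])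
         (s : spart m [::] [:: Black; White]),
  [/\ r \in C [::] [:: White; Black],
      s \in C [::] [:: Black; White],
      pcomp (ptensor (pinv r) (pid m [:: White]))
            (ptensor (pid m [:: White]) s) = pid m [:: White]
    & pcomp (ptensor (pinv s) (pid m [:: Black]))
            (ptensor (pid m [:: Black]) r) = pid m [:: Black] ].

Definition part_graded (m : nat) (n : 'I_m -> nat) (x y : word)
    (p : spart m x y) : Prop :=
  forall B, B \in blocks p ->
  forall a b : point m x y, a \in B -> b \in B -> n a.2 = n b.2.

Definition is_graded (m : nat) (n : 'I_m -> nat) (C : part_family m) : Prop :=
  forall x y (p : spart m x y), p \in C x y -> part_graded n p.

(** * Flattening *)

Definition flat_word (z w : word) : word :=
  flatten [seq if c is White then z else wbar z | c <- w].

Lemma size_flat_word z w : size (flat_word z w) = (size w * size z)%N.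
Proof.
rewrite /flat_word size_flatten /shape -map_comp sumnE big_map.
rewrite (eq_bigr (fun=> size z)) ?big_const_seq ?count_predT ?iter_addn_0 1?mulnC //.
by case=> _ //=; rewrite /wbar size_rev size_map.
Qed.

Section Flattening.
Variables (m : nat) (z : word).

Lemma level_subproof (l : 'I_(m * size z)) : (l %% m < m)%N.
Proof. by rewrite ltn_mod; case: m l => [|//] []. Qed.

(* A level l of an (m * d)-level partition is l = j + c * m; this is j *)
Definition level (l : 'I_(m * size z)) : 'I_m := Ordinal (level_subproof l).

(* ... and this is c, read from the left on white points and from the right on
   black points. *)
Definition offset (e : colour) (l : 'I_(m * size z)) : nat :=
  if e is White then l %/ m else ((size z).-1 - l %/ m)%N.

Lemma divl_subproof (l : 'I_(m * size z)) : (l %/ m < size z)%N.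
Proof.
have m0 : (0 < m)%N by case: m l => [|//] [].
by rewrite ltn_divLR //; apply: leq_trans (ltn_ord l) _; rewrite mulnC.
Qed.

Lemma offset_lt e l : (offset e l < size z)%N.
Proof.
have lz := divl_subproof l; case: e => //=.
by apply: leq_ltn_trans (leq_subr _ _) _; rewrite ltn_predL (leq_ltn_trans _ lz).
Qed.

Lemma flat_pos_subproof (w : word) (k : 'I_(size w)) (l : 'I_(m * size z)) :
  (k * size z + offset (letter k) l < size (flat_word z w))%N.
Proof.
rewrite size_flat_word; apply: (@leq_trans (k.+1 * size z)).
  by rewrite mulSn addnC ltn_add2r offset_lt.
by rewrite leq_mul2r ltn_ord orbT.
Qed.

Definition flat_pos (w : word) (k : 'I_(size w)) (l : 'I_(m * size z)) :
    'I_(size (flat_word z w)) :=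
  Ordinal (flat_pos_subproof k l).

(* As positions are counted separately on the two rows, the same formula serves
   for upper and lower points. *)
Definition flat_point (x y : word) (a : point (m * size z) x y) :
    point m (flat_word z x) (flat_word z y) :=
  (match a.1 with
   | inl k => inl (flat_pos k a.2)
   | inr k => inr (flat_pos k a.2)
   end, level a.2).

Lemma flat_pos_inj (w : word) (k k' : 'I_(size w)) (l l' : 'I_(m * size z)) :
  flat_pos k l = flat_pos k' l' -> level l = level l' -> k = k' /\ l = l'.
Proof.
move=> /(congr1 val) /= e /(congr1 val) /= el.
have z0 : (0 < size z)%N by apply: leq_ltn_trans (divl_subproof l).
have ek : k = k'.
  apply: val_inj => /=; move/(congr1 (fun t => t %/ size z)%N): e.
  by rewrite !divnMDl // !divn_small ?offset_lt // !addn0.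
split=> //; subst k'; apply: val_inj => /=.
rewrite (divn_eq (l : nat) m) (divn_eq (l' : nat) m) el; congr (_ * _ + _)%N.
have predI (d a b : nat) :
    (a < d -> b < d -> d.-1 - a = d.-1 - b -> a = b)%N.
  by case: d => // d; rewrite !ltnS /= => ad bd eab; rewrite -(subKn ad) eab subKn.
move/addnI: e; case: (letter k) => //=.
by apply: predI; apply: divl_subproof.
Qed.

Lemma flat_point_inj x y : injective (@flat_point x y).
Proof.
by move=> [[k|k] l] [[k'|k'] l'] // [ek el];
   have [-> ->] : k = k' /\ l = l' by
     apply: flat_pos_inj; apply: val_inj.
Qed.

Lemma flat_point_bij x y : bijective (@flat_point x y).
Proof.
apply: inj_card_bij (@flat_point_inj x y) _.
rewrite !card_prod !card_sum !card_ord !size_flat_word -mulnDl -mulnA.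
by rewrite (mulnC (size z)).
Qed.

Lemma flat_blocks_partition x y (p : spart (m * size z) x y) :
  partition [set [set flat_point a | a in B] | B : {set _} in blocks p]
            [set: point m (flat_word z x) (flat_word z y)].
Proof.
have [g fK gK] := flat_point_bij x y.
have <- : [set flat_point a | a in [set: point (m * size z) x y]]
          = [set: point m (flat_word z x) (flat_word z y)].
  by apply/setP=> b; rewrite inE -(gK b) imset_f.
by rewrite imset_partition ?blocksP //; apply: flat_point_inj.
Qed.

Definition flat (x y : word) (p : spart (m * size z) x y) :
    spart m (flat_word z x) (flat_word z y) :=
  SPart (flat_blocks_partition p).

Definition flat_preimage (C : part_family m) : part_family (m * size z) :=
  fun x y => [set p | flat p \in C (flat_word z x) (flat_word z y)].

(* The |z|-fold repetition n ... n. *)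
Definition repeat_dims (n : 'I_m -> nat) : 'I_(m * size z) -> nat :=
  fun l => n (level l).

End Flattening.

Arguments flat_preimage {m} z C x y.
Arguments repeat_dims {m} z n l.

(** * C*-algebras *)

Local Open Scope ring_scope.

(* A unital C*-algebra over the complex numbers R[i].  The hierarchies of
   algebras and of normed modules have no common extension that is not a number
   domain, so the norm and its completeness are stated here. *)
HB.mixin Record isCStarAlgebra (R : realType) A of GRing.Algebra R[i] A := {
  star : A -> A;
  cnorm : A -> R;
  starK : involutive star;
  starD : {morph star : a b / a + b};
  starZ : forall (c : R[i]) (a : A), star (c *: a) = c^* *: star a;
  starM : forall a b : A, star (a * b) = star b * star a;
  cnorm_eq0 : forall a : A, cnorm a = 0 -> a = 0;
  cnormD : forall a b : A, cnorm (a + b) <= cnorm a + cnorm b;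
  cnormZ : forall (c : R[i]) (a : A), (cnorm (c *: a))%:C%C = `|c| * (cnorm a)%:C%C;
  cnormM : forall a b : A, cnorm (a * b) <= cnorm a * cnorm b;
  cnorm_star : forall a : A, cnorm (star a * a) = cnorm a ^+ 2;
  cnorm_complete : forall u : nat -> A,
    (forall e : R, 0 < e -> exists N : nat, forall p q : nat,
       (N <= p)%N -> (N <= q)%N -> cnorm (u p - u q) < e) ->
    exists a : A, forall e : R, 0 < e -> exists N : nat, forall p : nat,
       (N <= p)%N -> cnorm (u p - a) < e }.

#[short(type="cstarAlgType")]
HB.structure Definition CStarAlgebra (R : realType) :=
  {A of GRing.Algebra R[i] A & isCStarAlgebra R A}.

Definition is_star_subalg (R : realType) (A : cstarAlgType R)
    (S : A -> Prop) : Prop :=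
  [/\ S 1, forall a b, S a -> S b -> S (a + b),
      forall a b, S a -> S b -> S (a * b),
      forall (c : R[i]) a, S a -> S (c *: a)
    & forall a, S a -> S (star a) ].

Definition is_dense_in (R : realType) (A : cstarAlgType R)
    (S : A -> Prop) (a : A) : Prop :=
  forall e : R, 0 < e -> exists2 b, S b & cnorm (a - b) < e.

Definition is_cstar_subalg (R : realType) (A : cstarAlgType R)
    (S : A -> Prop) : Prop :=
  is_star_subalg S /\ forall a, is_dense_in S a -> S a.

Definition star_gen (R : realType) (A : cstarAlgType R)
    (E : A -> Prop) (a : A) : Prop :=
  forall S : A -> Prop, is_star_subalg S -> (forall b, E b -> S b) -> S a.

Definition cstar_gen (R : realType) (A : cstarAlgType R)
    (E : A -> Prop) (a : A) : Prop :=
  forall S : A -> Prop, is_cstar_subalg S -> (forall b, E b -> S b) -> S a.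

(* f restricts to a unital *-homomorphism on the *-subalgebra S. *)
Definition star_hom_on (R : realType) (A B : cstarAlgType R)
    (S : A -> Prop) (f : A -> B) : Prop :=
  [/\ f 1 = 1, forall a b, S a -> S b -> f (a + b) = f a + f b,
      forall a b, S a -> S b -> f (a * b) = f a * f b,
      forall (c : R[i]) a, S a -> f (c *: a) = c *: f a
    & forall a, S a -> f (star a) = star (f a) ].

Definition star_hom (R : realType) (A B : cstarAlgType R) (f : A -> B) : Prop :=
  star_hom_on (fun=> True) f.

(* (T, l, r) is a C*-algebra containing the algebraic tensor product of A and B,
   a (x) b being l a * r b; the last clause is the injectivity of the map from
   the algebraic tensor product to T. *)
Definition contains_tensor (R : realType) (A B T : cstarAlgType R)
    (l : A -> T) (r : B -> T) : Prop :=
  [/\ star_hom l, star_hom r, forall a b, l a * r b = r b * l a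
    & forall (N : nat) (a : 'I_N -> A) (b : 'I_N -> B),
        (forall c : 'I_N -> R[i], \sum_k c k *: b k = 0 -> forall k, c k = 0) ->
        \sum_k l (a k) * r (b k) = 0 -> forall k, a k = 0 ].

(* (T, l, r) is the minimal C*-tensor product: the completion of the algebraic
   tensor product for its smallest C*-norm. *)
Definition is_tensor_product (R : realType) (A B T : cstarAlgType R)
    (l : A -> T) (r : B -> T) : Prop :=
  [/\ contains_tensor l r,
      forall t : T, is_dense_in
        (fun s => exists (N : nat) (a : 'I_N -> A) (b : 'I_N -> B),
           s = \sum_k l (a k) * r (b k)) t
    & forall (T' : cstarAlgType R) (l' : A -> T') (r' : B -> T'),
        contains_tensor l' r' ->
        forall (N : nat) (a : 'I_N -> A) (b : 'I_N -> B),
          cnorm (\sum_k l (a k) * r (b k)) <= cnorm (\sum_k l' (a k) * r' (b k)) ].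

(** * Operators and matrices *)

(* A finite-dimensional Hilbert space V is given by an orthonormal basis,
   indexed by a finite type I; the conjugate space has the conjugate basis,
   indexed by I again, and V (x) W has the basis I * J.  An operator from V to W
   is its matrix, the index in the basis of W coming first. *)
Section Operators.
Variable R : realType.
Implicit Types I J K : finType.

Definition op (J I : finType) := J -> I -> R[i].

Definition opcomp I J K (S : op K J) (T : op J I) : op K I :=
  fun i k => \sum_j S i j * T j k.

Definition opadj I J (T : op J I) : op I J := fun i j => (T j i)^*.

Definition opid I : op I I := fun i j => (i == j)%:R.

Definition optens I J I' J' (S : op J I) (T : op J' I') :
    op (J * J')%type (I * I')%type :=
  fun j i => S j.1 i.1 * T j.2 i.2.

Definition is_unitary_op I J (Q : op J I) : Prop :=
  opcomp (opadj Q) Q =2 @opid I /\ opcomp Q (opadj Q) =2 @opid J.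

(* The canonical identifications (V (x) W) (x) U = V (x) (W (x) U),
   C (x) V = V and V (x) C = V. *)
Definition opassoc I J K : op ((I * J) * K)%type (I * (J * K))%type :=
  fun a b => ((a.1.1, (a.1.2, a.2)) == b)%:R.

Definition oplunit I : op I (unit * I)%type := fun i a => (a.2 == i)%:R.

Definition oprunit I : op (I * unit)%type I := fun a i => (a.1 == i)%:R.

(* The basis of V^{(x) x} *)
Definition multi (I : finType) (x : word) : finType := {ffun 'I_(size x) -> I}.

Definition oppow I J (Q : op J I) (x : word) : op (multi J x) (multi I x) :=
  fun j i => \prod_(k < size x)
    if letter k is White then Q (j k) (i k) else (Q (j k) (i k))^*.

Variable A : cstarAlgType R.

Definition amat (I : finType) := I -> I -> A.

Definition atriv : amat unit := fun _ _ => 1.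

Definition atop I J (u : amat I) (v : amat J) : amat (I * J)%type :=
  fun i j => u i.1 j.1 * v i.2 j.2.

Definition aconj I (u : amat I) : amat I := fun i j => star (u i j).

Definition amul I (u v : amat I) : amat I := fun i j => \sum_k u i k * v k j.

Definition aid I : amat I := fun i j => (i == j)%:R.

Definition aadj I (u : amat I) : amat I := fun i j => star (u j i).

Definition is_unitary_amat I (u : amat I) : Prop :=
  amul u (aadj u) =2 @aid I /\ amul (aadj u) u =2 @aid I.

(* Invertible with entries of the inverse in the subalgebra S. *)
Definition invertible_in (S : A -> Prop) I (u : amat I) : Prop :=
  exists v : amat I, [/\ forall i j, S (v i j),
    amul u v =2 @aid I & amul v u =2 @aid I].

(* u^x for u^White = u and u^Black = ub; the product is ordered. *)
Definition apow I (u ub : amat I) (x : word) : amat (multi I x) :=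
  fun i j => \prod_(k < size x)
    (if letter k is White then u else ub) (i k) (j k).

Definition Hom I J (u : amat I) (v : amat J) (T : op J I) : Prop :=
  forall i j, \sum_k T i k *: u k j = \sum_k T k j *: v i k.

Definition conjugate_amat I (u ub : amat I) : Prop :=
  exists (r : op (I * I)%type unit) (s : op (I * I)%type unit),
  [/\ Hom atriv (atop u ub) r,
      Hom atriv (atop ub u) s,
      opcomp (@oplunit I) (opcomp (optens (opadj r) (@opid I)) (opcomp (@opassoc I I I)
        (opcomp (optens (@opid I) s) (@oprunit I)))) =2 @opid I
    & opcomp (@oplunit I) (opcomp (optens (opadj s) (@opid I)) (opcomp (@opassoc I I I)
        (opcomp (optens (@opid I) r) (@oprunit I)))) =2 @opid I ].

End Operators.

Arguments opid {R} I _ _.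
Arguments opassoc {R} I J K _ _.
Arguments oplunit {R} I _ _.
Arguments oprunit {R} I _ _.
Arguments oppow {R I J} Q x _ _.
Arguments apow {R A I} u ub x _ _.

(** * Compact matrix quantum groups *)

(* C(G) is given as a C*-subalgebra of an ambient C*-algebra: it is the
   subalgebra qfun G generated by the entries of the fundamental matrix
   (possibly everything).  The tensor square of C(G) is then the closed span of
   the elements qleft a * qright b, for a and b in C(G), in the minimal tensor
   square of the ambient algebra. *)
Record qdata (R : realType) (I : finType) := QData {
  qalg : cstarAlgType R;
  qsquare : cstarAlgType R;
  qleft : qalg -> qsquare;
  qright : qalg -> qsquare;
  qcomult : qalg -> qsquare;
  qfund : amat qalg I }.

Section QuantumGroups.
Variable R : realType.
Implicit Types I J : finType.

Definition qentry I (G : qdata R I) (a : qalg G) : Prop :=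
  exists i j, a = qfund G i j.

Definition qfun I (G : qdata R I) : qalg G -> Prop := cstar_gen (@qentry I G).

Definition qpol I (G : qdata R I) : qalg G -> Prop := star_gen (@qentry I G).

Definition comultiplicative I J (G : qdata R I) (v : amat (qalg G) J) : Prop :=
  forall i j, qcomult (v i j) = \sum_k qleft (v i k) * qright (v k j).

(* That the comultiplication maps C(G) to the tensor square of C(G) follows from
   its values on the generators. *)
Definition is_cmqg I (G : qdata R I) : Prop :=
  [/\ is_tensor_product (@qleft R I G) (@qright R I G),
      is_unitary_amat (qfund G),
      invertible_in (@qfun I G) (aconj (qfund G)),
      star_hom_on (@qfun I G) (@qcomult R I G)
    & comultiplicative (qfund G) ].

Definition is_rep I J (G : qdata R I) (v : amat (qalg G) J) : Prop :=
  [/\ forall i j, qfun (v i j), invertible_in (@qfun I G) v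
    & comultiplicative v ].

Definition is_unitary_rep I J (G : qdata R I) (v : amat (qalg G) J) : Prop :=
  is_rep v /\ is_unitary_amat v.

(* G^z = (A, u^z): since C(G) is generated by the entries, it is enough to
   replace the fundamental matrix. *)
Definition qpower I (G : qdata R I) (ub : amat (qalg G) I) (z : word) :
    qdata R (multi I z) :=
  {| qalg := qalg G; qsquare := qsquare G;
     qleft := @qleft R I G; qright := @qright R I G; qcomult := @qcomult R I G;
     qfund := apow (qfund G) ub z |}.

Definition equivalent I J (G : qdata R I) (H : qdata R J) : Prop :=
  [/\ is_cmqg G, is_cmqg H &
   exists (ub : amat (qalg G) I) (wb : amat (qalg H) J),
   [/\ is_unitary_rep ub, conjugate_amat (qfund G) ub,
       is_unitary_rep wb, conjugate_amat (qfund H) wb &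
     exists Q : op R J I, is_unitary_op Q /\
       forall (x y : word) (T : op R (multi I y) (multi I x)),
         Hom (apow (qfund G) ub x) (apow (qfund G) ub y) T <->
         exists2 S : op R (multi J y) (multi J x),
           Hom (apow (qfund H) wb x) (apow (qfund H) wb y) S &
           T =2 opcomp (oppow (opadj Q) y) (opcomp S (oppow Q x)) ] ].

(* The index set [n] of the canonical basis of C^n. *)
Definition labels (m : nat) (n : 'I_m -> nat) : finType :=
  {dffun forall l : 'I_m, 'I_(n l)}.

Definition point_label (m : nat) (n : 'I_m -> nat) (x y : word)
    (i : multi (labels n) y) (j : multi (labels n) x) (a : point m x y) : nat :=
  match a.1 with inl k => j k a.2 | inr k => i k a.2 end.

Definition part_op (m : nat) (n : 'I_m -> nat) (x y : word) (p : spart m x y) :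
    op R (multi (labels n) y) (multi (labels n) x) :=
  fun i j =>
    [forall B in blocks p, forall a in B, forall b in B,
       point_label i j a == point_label i j b]%:R.

Definition in_span (m : nat) (n : 'I_m -> nat) (C : part_family m) (x y : word)
    (T : op R (multi (labels n) y) (multi (labels n) x)) : Prop :=
  exists c : spart m x y -> R[i],
    T =2 fun i j => \sum_(p in C x y) c p * part_op p i j.

(* C(G) is the universal C*-completion of O(G). *)
Definition is_universal I (G : qdata R I) : Prop :=
  forall (B : cstarAlgType R) (f : qalg G -> B), star_hom_on (@qpol I G) f ->
  exists2 g : qalg G -> B, star_hom_on (@qfun I G) g &
    forall a, qpol a -> g a = f a.

(* (G, ub) is G_n(C) with its representation u^Black. *)
Definition is_partition_qgroup (m : nat) (n : 'I_m -> nat) (C : part_family m)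
    (G : qdata R (labels n)) (ub : amat (qalg G) (labels n)) : Prop :=
  [/\ is_cmqg G, is_unitary_rep ub,
      forall (x y : word) (T : op R (multi (labels n) y) (multi (labels n) x)),
        Hom (apow (qfund G) ub x) (apow (qfund G) ub y) T <-> in_span C T
    & is_universal G ].

End QuantumGroups.

(* Main.v *)
From mathcomp Require Import all_boot all_order all_algebra.
From mathcomp Require Import complex reals boolp.
Require Import Defs.

(** Flattening regroups every block of |z| consecutive tensor factors
    C^n (x) ... (x) C^n into one factor C^(n...n), reading black blocks backwards.
    With the conjugate U^black of U := u^z chosen as the product of the conjugate
    factors of u^z in reverse order, U^x becomes u^(Flat x) after regrouping, and
    T_(Flat p) becomes T_p; as Flat is a bijection of partitions from D(x, y) onto
    C(Flat x, Flat y), the Hom spaces of the two quantum groups correspond under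
    the permutation of basis vectors given by the regrouping.

    That U^black is conjugate to U is where rigidity enters.  If (r, s) solves the
    conjugate equations in C, then the product of the matrices of T_r and T_s is
    diagonal with nonzero entries, so the matrix of T_r is invertible; since T_r is
    a morphism 1 -> u (x) u^black, it follows that u^black is similar to the
    entrywise adjoint of u by a scalar matrix.  This similarity passes to tensor
    products, and for unitary matrices it gives back a solution of the conjugate
    equations; it also transfers to the second quantum group through the Hom
    spaces. *)

Set Implicit Arguments.
Unset Strict Implicit.
Unset Printing Implicit Defensive.
Import Order.TTheory GRing.Theory Num.Theory.
Local Open Scope ring_scope.

(** * Scalar matrices and conjugate matrices *)

Section Involution.
Variables (R : realType) (A : cstarAlgType R).
Implicit Types a b : A.

Lemma star0 : star (0 : A) = 0.
Proof. by apply: (addrI (star 0)); rewrite -starD !addr0. Qed.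

Lemma star1 : star (1 : A) = 1.
Proof. by rewrite -[LHS]mulr1 -{2}(starK 1) -starM mulr1 starK. Qed.

Lemma star_sum (J : finType) (F : J -> A) :
  star (\sum_k F k) = \sum_k star (F k).
Proof. exact: (big_morph _ (@starD R A) star0). Qed.

Lemma star_prod_ord (N : nat) (F : 'I_N -> A) :
  star (\prod_k F k) = \prod_k star (F (rev_ord k)).
Proof.
elim: N F => [|N IH] F; first by rewrite !big_ord0 star1.
rewrite big_ord_recl big_ord_recr /= starM IH; congr (_ * star (F _)).
  apply: eq_bigr => k _; congr (star (F _)); apply: val_inj.
  by rewrite /= /bump leq0n add1n -subSn // subSS.
by apply: val_inj; rewrite /= subnn.
Qed.

End Involution.

Section MatrixCalculus.
Variables (R : realType) (A : cstarAlgType R) (I : finType).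
Implicit Types (u v w : amat A I) (F K : op R I I).

(** Embedding scalar operators as [A]-valued matrices lets intertwining relations be manipulated as
    identities for [amul]. *)
Definition smat F : amat A I := fun i j => (F i j)%:A.
Definition atr u : amat A I := fun i j => u j i.
Definition optr F : op R I I := fun i j => F j i.
Definition opconj F : op R I I := fun i j => (F i j)^*.

Lemma amat_ext (T : Type) (f g : I -> I -> T) : f =2 g -> f = g.
Proof. by move=> e; apply/funext=> i; apply/funext=> j. Qed.

Lemma amulA u v w : amul u (amul v w) = amul (amul u v) w.
Proof.
apply: amat_ext => i j; rewrite /amul.
under eq_bigr do rewrite mulr_sumr.
rewrite exchange_big; apply: eq_bigr => k _.
by rewrite mulr_suml; apply: eq_bigr => l _; rewrite mulrA.
Qed.

Lemma sum_delta (V : pzRingType) (i : I) (f : I -> V) :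
  \sum_k (i == k)%:R * f k = f i.
Proof.
rewrite (bigD1 i) //= eqxx mul1r big1 ?addr0 // => k ki.
by rewrite eq_sym (negPf ki) mul0r.
Qed.

Lemma amul1l u : amul (@aid R A I) u = u.
Proof. by apply: amat_ext => i j; rewrite /amul /aid sum_delta. Qed.

Lemma amul1r u : amul u (@aid R A I) = u.
Proof.
apply: amat_ext => i j; rewrite /amul /aid -[RHS](sum_delta j (u i)).
by apply: eq_bigr => k _; rewrite eq_sym; case: eqP; rewrite ?mulr1 ?mul1r ?mulr0 ?mul0r.
Qed.

Lemma smatM F K : amul (smat F) (smat K) = smat (opcomp F K).
Proof.
apply: amat_ext => i j; rewrite /amul /smat /opcomp scaler_suml.
by apply: eq_bigr => k _; rewrite mulr_algl scalerA.
Qed.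

Lemma smat1 : smat (opid I) = @aid R A I.
Proof. by apply: amat_ext => i j; rewrite /smat /opid /aid scaler_nat. Qed.

Lemma smat_entry F u i j : amul (smat F) u i j = \sum_k F i k *: u k j.
Proof. by apply: eq_bigr => k _; rewrite mulr_algl. Qed.

Lemma smat_entryr F u i j : amul u (smat F) i j = \sum_k F k j *: u i k.
Proof. by apply: eq_bigr => k _; rewrite mulr_algr. Qed.

Lemma atr_smatl F u : atr (amul (smat F) u) = amul (atr u) (smat (optr F)).
Proof. by apply: amat_ext => i j; rewrite /atr smat_entry smat_entryr. Qed.

Lemma atr_smatr F u : atr (amul u (smat F)) = amul (smat (optr F)) (atr u).
Proof. by apply: amat_ext => i j; rewrite /atr smat_entry smat_entryr. Qed.

Lemma aconj_smatl F u : aconj (amul (smat F) u) = amul (smat (opconj F)) (aconj u).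
Proof.
apply: amat_ext => i j; rewrite /aconj !smat_entry star_sum.
by apply: eq_bigr => k _; rewrite starZ.
Qed.

Lemma aconj_smatr F u : aconj (amul u (smat F)) = amul (aconj u) (smat (opconj F)).
Proof.
apply: amat_ext => i j; rewrite /aconj !smat_entryr star_sum.
by apply: eq_bigr => k _; rewrite starZ.
Qed.

Lemma aconjK u : aconj (aconj u) = u.
Proof. by apply: amat_ext => i j; rewrite /aconj starK. Qed.

Lemma opcomp_conj F K :
  opcomp (opconj F) (opconj K) = opconj (opcomp F K).
Proof.
apply: amat_ext => i j; rewrite /opcomp /opconj rmorph_sum.
by apply: eq_bigr => k _; rewrite rmorphM.
Qed.

Lemma opcomp_tr F K : opcomp (optr F) (optr K) = optr (opcomp K F).
Proof.
by apply: amat_ext => i j; apply: eq_bigr => k _; rewrite /optr mulrC.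
Qed.

Lemma opconj_id : opconj (opid I) = opid I.
Proof. by apply: amat_ext => i j; rewrite /opconj /opid rmorph_nat. Qed.

Lemma optr_id : optr (opid I) = opid I.
Proof. by apply: amat_ext => i j; rewrite /optr /opid eq_sym. Qed.

(** In finite dimension a right inverse is a left inverse; enumerating [I] reduces this to square
    matrices. *)
Lemma opcomp_inv_sym F K : opcomp F K = opid I -> opcomp K F = opid I.
Proof.
pose M (E : op R I I) := \matrix_(i < #|I|, j < #|I|) E (enum_val i) (enum_val j).
have MM E E' : M (opcomp E E') = M E *m M E'.
  apply/matrixP=> i j; rewrite !mxE /opcomp.
  rewrite (reindex (enum_val (A := I))) /=; last first.
    by exists enum_rank => k _; rewrite ?enum_valK ?enum_rankK.
  by apply: eq_bigr => k _; rewrite !mxE.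
have M1 : M (opid I) = 1%:M.
  by apply/matrixP=> i j; rewrite !mxE /opid (inj_eq enum_val_inj).
move=> /(congr1 M); rewrite MM M1 => /mulmx1C; rewrite -MM -M1 => /matrixP e.
apply: amat_ext => i j; have := e (enum_rank i) (enum_rank j).
by rewrite !mxE !enum_rankK.
Qed.

Lemma unitary_amatE u :
  is_unitary_amat u <->
  amul u (aadj u) = @aid R A I /\ amul (aadj u) u = @aid R A I.
Proof.
split=> [[h1 h2]|[h1 h2]]; first by split; apply: amat_ext.
by split=> i j; rewrite ?h1 ?h2.
Qed.

(** A vector of the tensor product is read as a matrix [F]; being fixed by [u (x) v] then becomes
    [u F v^t = F]. *)
Lemma Hom_trivP u v (r : op R (I * I)%type unit) :
  Hom (@atriv R A) (atop u v) r <->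
  amul (amul u (smat (fun i j => r (i, j) tt))) (atr v) =
  smat (fun i j => r (i, j) tt).
Proof.
have E i j : amul (amul u (smat (fun i j => r (i, j) tt))) (atr v) i j =
    \sum_k r k tt *: atop u v (i, j) k.
  rewrite /amul /smat /atr /atop /=.
  under eq_bigr do rewrite mulr_suml.
  rewrite exchange_big pair_bigA /=; apply: eq_bigr => -[k l] _ /=.
  by rewrite mulr_algr scalerAl.
have E1 a b : \sum_(k : unit) r a k *: atriv A k b = (r a tt)%:A.
  by rewrite (bigD1 tt) //= big1 ?addr0 // => -[].
split=> [h|h].
  by apply: amat_ext => i j; rewrite E -h E1.
by move=> [i j] []; rewrite E1 -E h.
Qed.

(** Similarity of [v] to the entrywise adjoint of [u] by a scalar matrix. Unlike the conjugate
    equations, this passes directly to products. The inverse [K] is kept as a separate witness. *)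
Definition similar_to_conj u v :=
  exists F K : op R I I, [/\ opcomp F K = opid I, opcomp K F = opid I &
                   v = amul (smat F) (amul (aconj u) (smat K))].

Lemma smatK F K u : opcomp F K = opid I ->
  amul (smat F) (amul (smat K) u) = u.
Proof. by move=> h; rewrite amulA smatM h smat1 amul1l. Qed.

Lemma similar_to_conj_sym u v : similar_to_conj u v -> similar_to_conj v u.
Proof.
move=> [F [K [h h' ->]]]; exists (opconj K), (opconj F).
split; rewrite ?opcomp_conj ?h ?h' ?opconj_id //.
rewrite aconj_smatl aconj_smatr aconjK -!amulA smatM opcomp_conj h' opconj_id.
by rewrite smatK ?opcomp_conj ?h' ?opconj_id // smat1 amul1r.
Qed.

(** Solving [u F v^t = F] with [u] unitary gives [v^t = F^-1 u^* F], and transposing gives the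
    similarity. *)
Lemma Hom_triv_similar u v (r : op R (I * I)%type unit) K :
  is_unitary_amat u ->
  opcomp (fun i j => r (i, j) tt) K = opid I ->
  Hom (@atriv R A) (atop u v) r ->
  v = amul (smat (optr (fun i j => r (i, j) tt)))
        (amul (aconj u) (smat (optr K))).
Proof.
set F := (fun i j => r (i, j) tt).
move=> /unitary_amatE[_ uu] h /Hom_trivP; rewrite -/F => e.
have h' := opcomp_inv_sym h.
have {}e : atr v = amul (amul (smat K) (aadj u)) (smat F).
  by rewrite -e -!amulA (amulA (aadj u)) uu amul1l smatK.
rewrite -[v]/(atr (atr v)) e atr_smatr atr_smatl //.
Qed.

Lemma similar_Hom_triv u v F K :
  is_unitary_amat u -> opcomp F K = opid I ->
  v = amul (smat F) (amul (aconj u) (smat K)) ->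
  Hom (@atriv R A) (atop u v) (fun a _ => F a.2 a.1).
Proof.
move=> /unitary_amatE[uu _] h ->; apply/Hom_trivP; rewrite /=.
rewrite -[fun i j => F j i]/(optr F) atr_smatl atr_smatr -!amulA.
rewrite (@smatK (optr F) (optr K)); last by rewrite opcomp_tr (opcomp_inv_sym h) optr_id.
by rewrite (amulA u) -[atr (aconj u)]/(aadj u) uu amul1l.
Qed.

(* If [F] intertwines the contragredient of [u] with the unitary [v], then
   taking adjoints shows that the morphism [1 -> v (x) u] required for a
   conjugate is the conjugate inverse of [F]. *)
Lemma similar_conjugate u v :
  is_unitary_amat u -> is_unitary_amat v -> similar_to_conj u v ->
  conjugate_amat u v.
Proof.
move=> uU vU [F [K [h h' e]]].
have S : opcomp (opconj F) (opconj K) = opid I by rewrite opcomp_conj h opconj_id.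
exists (fun a _ => F a.2 a.1), (fun a _ => (K a.2 a.1)^*).
(* The identity, associator and unit factors are Kronecker deltas, so the conjugate equations
   collapse to equations between products of two scalar matrices. *)
have zigzag (r s : op R (I * I)%type unit) i k :
    opcomp (oplunit I) (opcomp (optens (opadj r) (opid I)) (opcomp (opassoc I I I)
        (opcomp (optens (opid I) s) (oprunit I)))) i k
    = \sum_j (r (k, j) tt)^* * s (j, i) tt.
  rewrite /opcomp /oplunit.
  rewrite (bigD1 (tt, i)) //= eqxx mul1r [X in _ + X]big1 ?addr0; last first.
    move=> [[] j] /=; case: (eqVneq j i) => [->|ji]; first by rewrite eqxx.
    by rewrite mul0r.
  transitivity (\sum_(a : (I * I) * I) optens (opadj r) (opid I) (tt, i) a *
      optens (opid I) s (a.1.1, (a.1.2, a.2)) (k, tt)).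
    apply: eq_bigr => a _; congr (_ * _).
    rewrite (bigD1 (a.1.1, (a.1.2, a.2))) //= [X in _ + X]big1 ?addr0; last first.
      by move=> b ba; rewrite /opassoc eq_sym (negPf ba) mul0r.
    rewrite /opassoc eqxx mul1r (bigD1 (k, tt)) //= [X in _ + X]big1 ?addr0.
      by rewrite /oprunit eqxx mulr1.
    move=> [j []]; rewrite /oprunit /=; case: (eqVneq k j) => [->|jk]; first by rewrite eqxx.
    by rewrite mulr0.
  transitivity (\sum_a1 \sum_a2 \sum_b optens (opadj r) (opid I) (tt, i) ((a1, a2), b) *
      optens (opid I) s (a1, (a2, b)) (k, tt)).
    by rewrite pair_bigA pair_bigA; apply: eq_bigr => -[[]].
  rewrite (bigD1 k) //= [X in _ + X]big1 ?addr0; last first.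
    move=> j jk; apply: big1 => j' _; apply: big1 => b _.
    by rewrite /optens /opid /= (negPf jk) mul0r mulr0.
  apply: eq_bigr => j _; rewrite (bigD1 i) //= big1 ?addr0; last first.
    by move=> b bi; rewrite /optens /opid /= eq_sym (negPf bi) !mulr0 mul0r.
  by rewrite /optens /opid /opadj /= !eqxx mulr1 mul1r.
split.
- exact: similar_Hom_triv uU h e.
- apply/Hom_trivP.
  rewrite /= -[fun i j => _]/(optr (opconj K)).
  have vv : amul (aadj v) v = @aid R A I by case/unitary_amatE: vU.
  have vv' : amul v (aadj v) = @aid R A I by case/unitary_amatE: vU.
  (* With [L] the conjugate transpose of [K], this gives [v^* L = L u^t]; multiplying by [v] on the
     left yields [v L u^t = L], the criterion of [Hom_trivP]. *)
  have ea : aadj v = amul (smat (optr (opconj K)))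
                       (amul (atr u) (smat (optr (opconj F)))).
    rewrite -[aadj v]/(atr (aconj v)) e aconj_smatl aconj_smatr aconjK.
    by rewrite atr_smatl atr_smatr -amulA.
  rewrite -amulA; have <- : amul (aadj v) (smat (optr (opconj K))) =
         amul (smat (optr (opconj K))) (atr u).
    by rewrite ea -!amulA smatM opcomp_tr (opcomp_inv_sym S) optr_id smat1 amul1r.
  by rewrite amulA vv' amul1l.
- move=> i k; rewrite zigzag -(opcomp_inv_sym S).
  by apply: eq_bigr => j _; rewrite /opconj /= mulrC.
- move=> i k; rewrite zigzag -h.
  by apply: eq_bigr => j _; rewrite /= conjCK mulrC.
Qed.

End MatrixCalculus.

(** * Subalgebras and products of matrices *)

Section Subalgebras.
Variables (R : realType) (A : cstarAlgType R).

Lemma cstar_gen_subalg (E : A -> Prop) : is_cstar_subalg (cstar_gen E).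
Proof.
split; first split.
- by move=> S [[]].
- by move=> a b ha hb S hS hE; case: (hS) => -[_ h _ _ _] _; apply: h; [apply: ha|apply: hb].
- by move=> a b ha hb S hS hE; case: (hS) => -[_ _ h _ _] _; apply: h; [apply: ha|apply: hb].
- by move=> c a ha S hS hE; case: (hS) => -[_ _ _ h _] _; apply: h; apply: ha.
- by move=> a ha S hS hE; case: (hS) => -[_ _ _ _ h] _; apply: h; apply: ha.
- move=> a ha S hS hE; case: (hS) => _; apply=> e /ha[b hb ab].
  by exists b => //; apply: hb.
Qed.

Variables (S : A -> Prop) (hS : is_star_subalg S).

Lemma subalg_sum (J : finType) (F : J -> A) :
  (forall k, S (F k)) -> S (\sum_k F k).
Proof.
case: hS => h1 hD _ hZ _ hF; elim/big_ind: _ => //.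
by rewrite -(scale0r 1); apply: hZ.
Qed.

Lemma subalg_prod (J : finType) (F : J -> A) :
  (forall k, S (F k)) -> S (\prod_k F k).
Proof. by case: hS => h1 _ hM _ _ hF; elim/big_ind: _. Qed.

Variable I : finType.
Implicit Types u v : amat A I.

Lemma subalg_smatl (F : op R I I) u :
  (forall i j, S (u i j)) -> forall i j, S (amul (smat A F) u i j).
Proof.
by case: hS => _ _ _ hZ _ hu i j; rewrite smat_entry; apply: subalg_sum => k; apply: hZ.
Qed.

Lemma subalg_smatr (F : op R I I) u :
  (forall i j, S (u i j)) -> forall i j, S (amul u (smat A F) i j).
Proof.
by case: hS => _ _ _ hZ _ hu i j; rewrite smat_entryr; apply: subalg_sum => k; apply: hZ.
Qed.

Lemma unitary_invertible_in u :
  is_unitary_amat u -> (forall i j, S (u i j)) -> invertible_in S u.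
Proof.
move=> [h1 h2] hu; exists (aadj u); split=> // i j.
by case: hS => _ _ _ _; apply.
Qed.

Lemma similar_to_conj_in u v :
  similar_to_conj u v -> (forall i j, S (u i j)) -> forall i j, S (v i j).
Proof.
move=> [F [K [_ _ ->]]] hu; apply: subalg_smatl; apply: subalg_smatr => i j.
by case: hS => _ _ _ _; apply.
Qed.

(** The conjugate of [u] equals [K v F], so its inverse is [K v^* F], whose entries are combinations
    of adjoints of entries of [v] and hence stay in [S]. *)
Lemma similar_to_conj_inv u v :
  similar_to_conj u v -> is_unitary_amat v -> (forall i j, S (u i j)) ->
  invertible_in S (aconj u).
Proof.
move=> uv vU hu; have hv := similar_to_conj_in uv hu.
case: uv => F [K [h h' e]]; case/unitary_amatE: vU => v1 v2.
have eu : aconj u = amul (smat A K) (amul v (smat A F)).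
  by rewrite e -!amulA smatM h' smat1 amul1r smatK.
exists (amul (smat A K) (amul (aadj v) (smat A F))); split.
- apply: subalg_smatl; apply: subalg_smatr => i j.
  by case: hS => _ _ _ _; apply.
- have -> // : amul (aconj u) (amul (smat A K) (amul (aadj v) (smat A F))) = @aid R A I.
  rewrite eu -!amulA (@smatK _ _ _ F K) // (amulA v) v1 amul1l.
  by rewrite smatM h' smat1.
- have -> // : amul (amul (smat A K) (amul (aadj v) (smat A F))) (aconj u) = @aid R A I.
  rewrite eu -!amulA (@smatK _ _ _ F K) // (amulA (aadj v)) v2 amul1l.
  by rewrite smatM h' smat1.
Qed.

End Subalgebras.

(** * Ordered products of matrices *)

Section Products.
Variables (R : realType) (A : cstarAlgType R) (I : finType).

Definition aprod (N : nat) (v : 'I_N -> amat A I) : amat A {ffun 'I_N -> I} :=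
  fun i j => \prod_k v k (i k) (j k).

(** The factors are multiplied in reverse order while the multi-index keeps its order: the shape
    that [star] gives to the entries of [aprod]. *)
Definition arevprod (N : nat) (v : 'I_N -> amat A I) : amat A {ffun 'I_N -> I} :=
  fun i j => \prod_k v (rev_ord k) (i (rev_ord k)) (j (rev_ord k)).

Definition optensor (N : nat) (F : 'I_N -> op R I I) :
    op R {ffun 'I_N -> I} {ffun 'I_N -> I} :=
  fun i j => \prod_k F k (i k) (j k).

Lemma aconj_aprod N (v : 'I_N -> amat A I) :
  aconj (aprod v) = arevprod (fun k => aconj (v k)).
Proof. by apply: amat_ext => i j; rewrite /aconj star_prod_ord. Qed.

Lemma revprod_sum (V : pzRingType) (N : nat) (F : 'I_N -> I -> V) :
  \prod_k \sum_a F (rev_ord k) a =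
  \sum_(f : {ffun 'I_N -> I}) \prod_k F (rev_ord k) (f (rev_ord k)).
Proof.
rewrite bigA_distr_bigA.
rewrite (reindex (fun f : {ffun 'I_N -> I} => [ffun k => f (rev_ord k)])) /=.
  by apply: eq_bigr => f _; apply: eq_bigr => k _; rewrite ffunE.
exists (fun f => [ffun k => f (rev_ord k)]) => f _; apply/ffunP => k;
by rewrite !ffunE rev_ordK.
Qed.

Lemma prod_rev (V : comPzRingType) N (c : 'I_N -> V) :
  \prod_k c (rev_ord k) = \prod_k c k.
Proof. by rewrite [RHS](reindex_inj rev_ord_inj). Qed.

Lemma arevprod_smatl N (F : 'I_N -> op R I I) (v : 'I_N -> amat A I) :
  arevprod (fun k => amul (smat A (F k)) (v k)) =
  amul (smat A (optensor F)) (arevprod v).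
Proof.
apply: amat_ext => i j; rewrite smat_entry /arevprod.
under eq_bigr do rewrite smat_entry.
rewrite (revprod_sum (fun k a => F k (i k) a *: v k a (j k))).
by apply: eq_bigr => f _; rewrite scaler_prod (prod_rev (fun k => F k (i k) (f k))).
Qed.

Lemma arevprod_smatr N (F : 'I_N -> op R I I) (v : 'I_N -> amat A I) :
  arevprod (fun k => amul (v k) (smat A (F k))) =
  amul (arevprod v) (smat A (optensor F)).
Proof.
apply: amat_ext => i j; rewrite smat_entryr /arevprod.
under eq_bigr do rewrite smat_entryr.
rewrite (revprod_sum (fun k a => F k a (j k) *: v k (i k) a)).
by apply: eq_bigr => f _; rewrite scaler_prod (prod_rev (fun k => F k (f k) (j k))).
Qed.

Lemma optensor_id N : optensor (fun _ : 'I_N => @opid R I) = opid _.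
Proof.
apply: amat_ext => i j; rewrite /optensor /opid.
have [->|ij] := eqVneq i j; first by apply: big1 => k _; rewrite eqxx.
have [k ik] : exists k, i k != j k.
  apply/existsP; apply: contraNT ij => /existsPn h.
  by apply/eqP/ffunP => k; apply/eqP/negPn/h.
by rewrite (bigD1 k) //= (negPf ik) mul0r.
Qed.

Lemma opcomp_optensor N (F K : 'I_N -> op R I I) :
  opcomp (optensor F) (optensor K) = optensor (fun k => opcomp (F k) (K k)).
Proof.
apply: amat_ext => i j; rewrite /optensor /opcomp bigA_distr_bigA.
by apply: eq_bigr => f _; rewrite big_split.
Qed.

(** Scalars are central, so the similarities of the factors can be pulled out of the reversed
    product and collected into tensor products of scalar matrices. *)
Lemma similar_to_conj_aprod N (v w : 'I_N -> amat A I) :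
  (forall k, similar_to_conj (v k) (w k)) ->
  similar_to_conj (aprod v) (arevprod w).
Proof.
move=> /choice[F /choice[K h]].
have e1 : (fun k => opcomp (F k) (K k)) = fun=> opid I.
  by apply/funext => k; case: (h k).
have e2 : (fun k => opcomp (K k) (F k)) = fun=> opid I.
  by apply/funext => k; case: (h k).
exists (optensor F), (optensor K); split.
- by rewrite opcomp_optensor e1 optensor_id.
- by rewrite opcomp_optensor e2 optensor_id.
rewrite aconj_aprod -arevprod_smatr -arevprod_smatl; congr arevprod.
by apply/funext => k; case: (h k).
Qed.

(** Multi-indices are split into head and tail for an induction on the number of factors, as the
    entries do not commute. *)
Definition ftail (N : nat) (i : {ffun 'I_N.+1 -> I}) : {ffun 'I_N -> I} :=
  [ffun k => i (lift ord0 k)].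

Definition fcons (N : nat) (a : I) (i : {ffun 'I_N -> I}) : {ffun 'I_N.+1 -> I} :=
  [ffun k => if unlift ord0 k is Some l then i l else a].

Lemma fcons0 N a (i : {ffun 'I_N -> I}) : fcons a i ord0 = a.
Proof. by rewrite ffunE unlift_none. Qed.

Lemma fconsK N a (i : {ffun 'I_N -> I}) : ftail (fcons a i) = i.
Proof. by apply/ffunP => k; rewrite !ffunE liftK. Qed.

Lemma fcons_eta N (i : {ffun 'I_N.+1 -> I}) : fcons (i ord0) (ftail i) = i.
Proof. by apply/ffunP => k; rewrite !ffunE; case: unliftP => [l|] ->; rewrite ?ffunE. Qed.

Lemma sum_fcons (V : nmodType) N (F : {ffun 'I_N.+1 -> I} -> V) :
  \sum_f F f = \sum_a \sum_g F (fcons a g).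
Proof.
rewrite pair_bigA /= (reindex (fun p : I * {ffun 'I_N -> I} => fcons p.1 p.2)) //=.
exists (fun f : {ffun 'I_N.+1 -> I} => (f ord0, ftail f)) => [[a g] _|f _] /=;
  last exact: fcons_eta.
by rewrite fcons0 fconsK.
Qed.

Lemma aprodS N (v : 'I_N.+1 -> amat A I) i j :
  aprod v i j = v ord0 (i ord0) (j ord0) *
    aprod (fun k => v (lift ord0 k)) (ftail i) (ftail j).
Proof.
by rewrite /aprod big_ord_recl; congr (_ * _); apply: eq_bigr => k _; rewrite !ffunE.
Qed.

Lemma aid_ffunS N (i j : {ffun 'I_N.+1 -> I}) :
  @aid R A _ i j = @aid R A _ (i ord0) (j ord0) * @aid R A _ (ftail i) (ftail j).
Proof.
rewrite /aid -natrM mulnb; congr ((nat_of_bool _)%:R).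
apply/eqP/andP => [->|[/eqP e0 /eqP et]]; first by rewrite !eqxx.
by rewrite -(fcons_eta i) e0 et fcons_eta.
Qed.

(** The innermost pair must be summed first: for [v v^*] this is the tail, where the induction
    hypothesis applies, and for [v^* v] it is the head. *)
Lemma unitary_aprod N (v : 'I_N -> amat A I) :
  (forall k, is_unitary_amat (v k)) -> is_unitary_amat (aprod v).
Proof.
elim: N v => [|N IH] v hv.
  have e (i j : {ffun 'I_0 -> I}) : i = j by apply/ffunP => -[].
  by split=> i j; rewrite /amul /aid /aadj (e i j) eqxx (bigD1 j) //= big1 ?addr0;
    rewrite ?/aprod ?big_ord0 ?star1 ?mulr1 // => k; rewrite (e k j) eqxx.
have [h1 h2] := IH _ (fun k => hv (lift ord0 k)); have [v1 v2] := hv ord0.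
split=> i j; rewrite /amul sum_fcons aid_ffunS /aadj.
- rewrite -v1 /amul mulr_suml; apply: eq_bigr => a _.
  under eq_bigr do rewrite !aprodS !fcons0 !fconsK starM mulrA -(mulrA (v _ _ _)).
  rewrite -mulr_suml -mulr_sumr -[X in _ * X * _]/(amul _ (aadj _) _ _) h1 /aadj /aid.
  by case: eqP; rewrite ?mulr1 // !mulr0 mul0r.
- rewrite exchange_big /= -h2 /amul mulr_sumr; apply: eq_bigr => g _.
  under eq_bigr do rewrite !aprodS !fcons0 !fconsK starM -!mulrA (mulrA (star (v _ _ _))).
  rewrite -mulr_sumr -mulr_suml -[X in _ * (X * _)]/(amul (aadj _) _ _ _) v2 /aadj /aid.
  by case: eqP; rewrite ?mul1r // !mul0r mulr0.
Qed.

End Products.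

Lemma prod_commute (V : pzRingType) N (a b : 'I_N -> V) :
  (forall k l, a k * b l = b l * a k) ->
  \prod_k (a k * b k) = (\prod_k a k) * (\prod_k b k).
Proof.
elim: N a b => [|N IH] a b ab; first by rewrite !big_ord0 mulr1.
rewrite !big_ord_recl IH // -!mulrA; congr (_ * _); rewrite !mulrA; congr (_ * _).
by apply: (big_ind (fun c => b ord0 * c = c * b ord0)) => [|c d hc hd|k _];
  rewrite ?mulr1 ?mul1r // mulrA hc -mulrA hd mulrA.
Qed.

(** Expanding the product of the sums for the factors interleaves [qleft] and [qright] terms; their
    images commute, so [prod_commute] separates the two legs. *)
Lemma comult_aprod (R : realType) I J (G : qdata R I) N
    (v : 'I_N -> amat (qalg G) J) :
  is_cmqg G -> (forall k i j, qfun (v k i j)) ->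
  (forall k, comultiplicative (v k)) -> comultiplicative (aprod v).
Proof.
move=> [[[[l1 _ lM _ _] [r1 _ rM _ _] lr _] _ _] _ _ [d1 _ dM _ _] _] hv cv i j.
have [[q1 _ qM _ _] _] := cstar_gen_subalg (@qentry R I G).
have -> : qcomult (aprod v i j) = \prod_k qcomult (v k (i k) (j k)).
  (* [qcomult] is assumed multiplicative only on [qfun], so membership is carried through the
     induction. *)
  apply: (proj2 (_ : qfun (aprod v i j) /\ _)); rewrite /aprod.
  elim/big_ind2: _ => [|a b c d [ha <-] [hc <-]|k _].
  - by split.
  - by split; [apply: qM | apply: dM].
  - by split; first exact: hv.
under eq_bigr do rewrite cv.
rewrite bigA_distr_bigA; apply: eq_bigr => f _.
rewrite prod_commute //; congr (_ * _); symmetry; apply: big_morph => // a b.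
- exact: lM.
- exact: rM.
Qed.

(** * Partitions and rigidity *)

Section Blocks.
Variable m : nat.
Implicit Types x y z : word.

Definition same_block x y (p : spart m x y) (a b : point m x y) : bool :=
  b \in pblock p a.

Lemma same_blockP x y (p : spart m x y) a b :
  reflect (exists2 B, B \in blocks p & (a \in B) && (b \in B)) (same_block p a b).
Proof.
have /and3P[/eqP cp tp _] := blocksP p.
have ac : a \in cover p by rewrite cp inE.
apply: (iffP idP) => [h|[B Bp /andP[aB bB]]].
  by exists (pblock p a); rewrite ?pblock_mem // mem_pblock ac.
by rewrite /same_block (def_pblock tp Bp aB).
Qed.

Lemma same_block_pblock x y (p : spart m x y) a b :
  (pblock p a == pblock p b) = same_block p a b.
Proof.
by have /and3P[/eqP cp tp _] := blocksP p; rewrite eq_pblock // cp inE.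
Qed.

Lemma same_block_ext x y (p q : spart m x y) :
  same_block p =2 same_block q -> p = q.
Proof.
move=> e; apply: val_inj => /=.
rewrite -(preim_partition_pblock (blocksP p)) -(preim_partition_pblock (blocksP q)).
have E : (fun a b => pblock p a == pblock p b) =2 (fun a b => pblock q a == pblock q b).
  by move=> a b; rewrite !same_block_pblock e.
apply: eq_in_imset => a _; apply/setP => b; rewrite !inE; exact: E.
Qed.

Lemma same_block_labels x y (T : eqType) (f : point m x y -> T) a b :
  same_block (part_of_labels f) a b = (f a == f b).
Proof.
rewrite /same_block pblock_equivalence_partition ?inE //.
by move=> c d e _ _ _ /=; split=> // /eqP ->.
Qed.

Lemma same_block_pinv x y (p : spart m x y) a b :
  same_block (pinv p) a b = same_block p (swap_point a) (swap_point b).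
Proof. by rewrite same_block_labels same_block_pblock. Qed.

Definition left_point x x' y y' (a : point m x y) : point m (x ++ x') (y ++ y') :=
  (match a.1 with
   | inl k => inl (cast_ord (esym (size_cat x x')) (lshift _ k))
   | inr k => inr (cast_ord (esym (size_cat y y')) (lshift _ k))
   end, a.2).

Definition right_point x x' y y' (a : point m x' y') : point m (x ++ x') (y ++ y') :=
  (match a.1 with
   | inl k => inl (cast_ord (esym (size_cat x x')) (rshift _ k))
   | inr k => inr (cast_ord (esym (size_cat y y')) (rshift _ k))
   end, a.2).

Lemma split_left_point x x' y y' (a : point m x y) :
  split_point (left_point x' y' a) = inl a.
Proof.
by case: a => [[k|k] l]; rewrite /split_point /left_point /split_pos /= cast_ordKV;
  rewrite -[lshift _ k]/(unsplit (inl k)) unsplitK.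
Qed.

Lemma split_right_point x x' y y' (a : point m x' y') :
  split_point (right_point x y a) = inr a.
Proof.
by case: a => [[k|k] l]; rewrite /split_point /right_point /split_pos /= cast_ordKV;
  rewrite -[rshift _ k]/(unsplit (inr k)) unsplitK.
Qed.

Variant tensor_point_spec x x' y y' : point m (x ++ x') (y ++ y') -> Type :=
| LeftPoint a : tensor_point_spec (left_point x' y' a)
| RightPoint a : tensor_point_spec (right_point x y a).

Lemma tensor_pointP x x' y y' (a : point m (x ++ x') (y ++ y')) :
  tensor_point_spec a.
Proof.
case: a => [[k|k] l]; rewrite -(cast_ordK (size_cat _ _) k);
  case: (split_ordP (cast_ord (size_cat _ _) k)) => k' ->.
- exact: (LeftPoint x' y' (inl k', l)).
- exact: (RightPoint x y (inl k', l)).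
- exact: (LeftPoint x' y' (inr k', l)).
- exact: (RightPoint x y (inr k', l)).
Qed.

Lemma same_block_left x x' y y' (p : spart m x y) (p' : spart m x' y') a b :
  same_block (ptensor p p') (left_point x' y' a) (left_point x' y' b) =
  same_block p a b.
Proof. by rewrite same_block_labels !split_left_point -same_block_pblock. Qed.

Lemma same_block_right x x' y y' (p : spart m x y) (p' : spart m x' y') a b :
  same_block (ptensor p p') (right_point x y a) (right_point x y b) =
  same_block p' a b.
Proof. by rewrite same_block_labels !split_right_point -same_block_pblock. Qed.

Lemma same_block_left_right x x' y y' (p : spart m x y) (p' : spart m x' y') a b :
  same_block (ptensor p p') (left_point x' y' a) (right_point x y b) = false.
Proof. by rewrite same_block_labels split_right_point split_left_point. Qed.

Lemma same_block_right_left x x' y y' (p : spart m x y) (p' : spart m x' y') a b :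
  same_block (ptensor p p') (right_point x y a) (left_point x' y' b) = false.
Proof. by rewrite same_block_labels split_right_point split_left_point. Qed.

Section Glue.
Variables (x y z : word) (p : spart m y z) (q : spart m x y).

Lemma glueP a b :
  reflect ((exists a' b', [/\ same_block q a' b', a = in_top z a' & b = in_top z b'])
        \/ (exists a' b', [/\ same_block p a' b', a = in_bot x a' & b = in_bot x b']))
    (glue p q a b).
Proof.
apply: (iffP orP) => -[h|h]; [left|right|left|right].
- have /existsP[B /andP[Bq /andP[/imsetP[a' aB ->] /imsetP[b' bB ->]]]] := h.
  by exists a', b'; split=> //; apply/same_blockP; exists B; rewrite ?aB.
- have /existsP[B /andP[Bq /andP[/imsetP[a' aB ->] /imsetP[b' bB ->]]]] := h.
  by exists a', b'; split=> //; apply/same_blockP; exists B; rewrite ?aB.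
- case: h => a' [b' [/same_blockP[B Bq /andP[aB bB]] -> ->]].
  by apply/existsP; exists B; rewrite Bq !imset_f.
- case: h => a' [b' [/same_blockP[B Bq /andP[aB bB]] -> ->]].
  by apply/existsP; exists B; rewrite Bq !imset_f.
Qed.

Lemma glue_connect_sym : connect_sym (glue p q).
Proof.
apply: sym_connect_sym => a b.
by rewrite /glue; congr (_ || _); apply: eq_existsb => B; rewrite [X in _ && X]andbC.
Qed.

Lemma glue_invariant (T : Type) (f : glued_point m x y z -> T) :
  (forall a b, same_block q a b -> f (in_top z a) = f (in_top z b)) ->
  (forall a b, same_block p a b -> f (in_bot x a) = f (in_bot x b)) ->
  forall a b, connect (glue p q) a b -> f a = f b.
Proof.
move=> hq hp a b /connectP[s]; elim: s a => [|c s IH] a /=; first by move=> _ ->.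
move=> /andP[/glueP ac sp] e; rewrite -(IH _ sp e).
by case: ac => -[a' [b' [h -> ->]]]; [apply: hq | apply: hp].
Qed.

Lemma same_block_pcomp a b :
  same_block (pcomp p q) a b = connect (glue p q) (in_outer y a) (in_outer y b).
Proof.
rewrite same_block_labels; apply/eqP/idP => [/setP/(_ (in_outer y b))|h].
  by rewrite !inE connect0.
by apply/setP=> c; rewrite !inE (same_connect glue_connect_sym h).
Qed.

End Glue.

Definition point_consistent (n : 'I_m -> nat) x y (p : spart m x y)
    (i : multi (labels n) y) (j : multi (labels n) x) :=
  forall a b, same_block p a b -> point_label i j a = point_label i j b.

Lemma part_opP (n : 'I_m -> nat) x y (p : spart m x y)
    (i : multi (labels n) y) (j : multi (labels n) x) :
  reflect (point_consistent p i j)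
    [forall B in blocks p, forall a in B, forall b in B,
       point_label i j a == point_label i j b].
Proof.
apply: (iffP 'forall_in_'forall_in_'forall_in_eqP) => [h a b|h B Bp a aB b bB].
  by case/same_blockP => B Bp /andP[aB bB]; apply: h bB.
by apply: h; apply/same_blockP; exists B; rewrite ?aB.
Qed.

End Blocks.

Definition nil_index (I : finType) : multi I [::] :=
  ffun0 (card_ord 0).

Definition pair_index (I : finType) (c d : colour) (i j : I) : multi I [:: c; d] :=
  [ffun k : 'I_2 => if k == ord0 then i else j].

(** * Invertibility of the matrix of a solution of the conjugate equations *)

Section Rigid.
Variables (m : nat) (n : 'I_m -> nat).
Variables (r : spart m [::] [:: White; Black]) (s : spart m [::] [:: Black; White]).
Let p := ptensor (pinv r) (pid m [:: White]).
Let q := ptensor (pid m [:: White]) s.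
Hypothesis comp_rs : pcomp p q = pid m [:: White].
Hypothesis (gp : part_graded n p) (gq : part_graded n q).

Let up (l : 'I_m) : point m [:: White] [:: White] := (inl ord0, l).
Let down (l : 'I_m) : point m [:: White] [:: White] := (inr ord0, l).
Let upper (l : 'I_m) := in_outer [:: White; Black; White] (up l).

(** The composite is the identity on a single column, whose blocks are exactly the levels. *)
Lemma outer_connect (a b : point m [:: White] [:: White]) :
  connect (glue p q) (in_outer _ a) (in_outer _ b) = (a.2 == b.2).
Proof.
rewrite -(same_block_pcomp p q) comp_rs same_block_labels xpair_eqE.
suff -> : match a.1 with inl k => k | inr k => k end ==
          match b.1 with inl k => k | inr k => k end by [].
by case: a.1 => k; case: b.1 => k'; rewrite [k]ord1 [k']ord1.
Qed.

Let q_left a b : same_block q (left_point [::] [:: Black; White] a)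
    (left_point [::] [:: Black; White] b) = same_block (pid m [:: White]) a b.
Proof. exact: (same_block_left (pid m [:: White]) s). Qed.

Let q_right a b : same_block q (right_point [:: White] [:: White] a)
    (right_point [:: White] [:: White] b) = same_block s a b.
Proof. exact: (same_block_right (pid m [:: White]) s). Qed.

Let q_lr a b : same_block q (left_point [::] [:: Black; White] a)
    (right_point [:: White] [:: White] b) = false.
Proof. exact: (same_block_left_right (pid m [:: White]) s). Qed.

Let q_rl a b : same_block q (right_point [:: White] [:: White] a)
    (left_point [::] [:: Black; White] b) = false.
Proof. exact: (same_block_right_left (pid m [:: White]) s). Qed.

Let p_left a b : same_block p (left_point [:: White] [:: White] a)
    (left_point [:: White] [:: White] b) = same_block (pinv r) a b.
Proof. exact: (same_block_left (pinv r) (pid m [:: White])). Qed.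

Let p_right a b : same_block p (right_point [:: White; Black] [::] a)
    (right_point [:: White; Black] [::] b) = same_block (pid m [:: White]) a b.
Proof. exact: (same_block_right (pinv r) (pid m [:: White])). Qed.

Let p_lr a b : same_block p (left_point [:: White] [:: White] a)
    (right_point [:: White; Black] [::] b) = false.
Proof. exact: (same_block_left_right (pinv r) (pid m [:: White])). Qed.

Let p_rl a b : same_block p (right_point [:: White; Black] [::] a)
    (left_point [:: White] [:: White] b) = false.
Proof. exact: (same_block_right_left (pinv r) (pid m [:: White])). Qed.

(** Label the upper row and first middle column by [i], the second middle column by [j], the third
    and the lower row by [k]. The labelling is constant on components, and each component of an
    outer point joins top to bottom on its level. *)
Lemma rigid_consistent_eq (i j k : labels n) :
  point_consistent r (pair_index _ _ i j) (nil_index _) ->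
  point_consistent s (pair_index _ _ j k) (nil_index _) -> i = k.
Proof.
move=> hr hs; apply/ffunP => l; apply: val_inj.
pose f (a : glued_point m [:: White] [:: White; Black; White] [:: White]) : nat :=
  match a.1 with
  | inl (inl _) => i a.2
  | inl (inr t) => (if t == 0%N :> nat then i else if t == 1%N :> nat then j else k) a.2
  | inr _ => k a.2
  end.
suff inv : forall a b, connect (glue p q) a b -> f a = f b.
  apply: (inv (in_outer _ (up l)) (in_outer _ (down l))).
  by rewrite outer_connect.
apply: glue_invariant => a b.
- case: (@tensor_pointP _ [:: White] [::] [:: White] [:: Black; White] a) => {}a;
    case: (@tensor_pointP _ [:: White] [::] [:: White] [:: Black; White] b) => {}b.
  + move=> ab; have := etrans (esym (q_left _ _)) ab.
    rewrite same_block_labels xpair_eqE => /andP[_ /eqP].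
    by case: a b {ab} => [[ka|ka] la] [[kb|kb] lb] /= <-; rewrite /f /= ?[ka]ord1 ?[kb]ord1.
  + by move=> ab; have := etrans (esym (q_lr _ _)) ab.
  + by move=> ab; have := etrans (esym (q_rl _ _)) ab.
  + move=> ab; have := etrans (esym (q_right _ _)) ab => /hs.
    case: a b {ab} => [[[]//|[[|[|//]] ka] la]] [[[]//|[[|[|//]] kb] lb]];
    by rewrite /point_label /= !ffunE /f /=.
- case: (@tensor_pointP _ [:: White; Black] [:: White] [::] [:: White] a) => {}a;
    case: (@tensor_pointP _ [:: White; Black] [:: White] [::] [:: White] b) => {}b.
  + move=> ab; have := etrans (esym (p_left _ _)) ab; rewrite same_block_pinv => /hr.
    case: a b {ab} => [[[[|[|//]] ka]|[]//] la] [[[[|[|//]] kb]|[]//] lb];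
    by rewrite /point_label /= !ffunE /f /=.
  + by move=> ab; have := etrans (esym (p_lr _ _)) ab.
  + by move=> ab; have := etrans (esym (p_rl _ _)) ab.
  + move=> ab; have := etrans (esym (p_right _ _)) ab.
    rewrite same_block_labels xpair_eqE => /andP[_ /eqP].
    by case: a b {ab} => [[ka|ka] la] [[kb|kb] lb] /= <-; rewrite /f /= ?[ka]ord1 ?[kb]ord1.
Qed.

Lemma same_block_graded x y (t : spart m x y) a b :
  part_graded n t -> same_block t a b -> n a.2 = n b.2.
Proof. by move=> g /same_blockP[B /g h /andP[]]; apply: h. Qed.

(* Each connected component of the diagram with an outer point gets the label
   prescribed there; closed components get the label 0. *)
Lemma rigid_consistent_ex (i : labels n) :
  exists j, point_consistent r (pair_index _ _ i j) (nil_index _) /\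
            point_consistent s (pair_index _ _ j i) (nil_index _).
Proof.
pose f (a : glued_point m [:: White] [:: White; Black; White] [:: White]) : nat :=
  if [pick l | connect (glue p q) a (upper l)] is Some l then i l else 0%N.
have fE a b : connect (glue p q) a b -> f a = f b.
  move=> ab; rewrite /f (eq_pick (Q := fun l => connect (glue p q) b (upper l))) //.
  by move=> l /=; rewrite (same_connect (@glue_connect_sym _ _ _ _ p q) ab).
have ft a b : same_block q a b -> f (in_top _ a) = f (in_top _ b).
  by move=> ab; apply/fE/connect1/glueP; left; exists a, b.
have fb a b : same_block p a b -> f (in_bot _ a) = f (in_bot _ b).
  by move=> ab; apply/fE/connect1/glueP; right; exists a, b.
(* Distinct levels of the upper row lie in distinct components, so [pick] can only return [l]. *)
have fup l : f (upper l) = i l.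
  rewrite /f; case: pickP => [l'|/(_ l)]; last by rewrite connect0.
  by rewrite outer_connect => /eqP /= <-.
(* The label may come from another level, but gradedness makes [n] constant along a component. The
   default 0 is in range because [i a.2] witnesses that [n a.2] is positive. *)
have flt a : (f a < n a.2)%N.
  have n0 : (0 < n a.2)%N by apply: leq_ltn_trans (ltn_ord (i a.2)).
  rewrite /f; case: pickP => [l al|//].
  suff -> : n a.2 = n l by [].
  apply: (glue_invariant (f := fun a => n a.2) _ _ al) => b c.
    exact: same_block_graded gq.
  exact: same_block_graded gp.
pose mid (t : 'I_3) (l : 'I_m) : glued_point m [:: White] [:: White; Black; White] [:: White] :=
  (inl (inr t), l).
have f0 l : f (mid ord0 l) = i l.
  rewrite -fup; have := ft (left_point [::] [:: Black; White] (down l))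
                          (left_point [::] [:: Black; White] (up l)).
  move=> /(_ (etrans (q_left _ _) _)); rewrite same_block_labels eqxx => /(_ erefl) e.
  by rewrite /upper; etransitivity; [|etransitivity; [exact: e|]];
    congr (f (_, _)); congr (inl _); congr (_ _); apply: val_inj.
(* The third middle column meets the lower row through the identity in [p], and the lower row meets
   the upper one through the whole diagram. *)
have f2 l : f (mid ord_max l) = i l.
  rewrite -fup -(fE (in_outer _ (down l)) (upper l)); last by rewrite /upper outer_connect eqxx.
  have := fb (right_point [:: White; Black] [::] (up l))
             (right_point [:: White; Black] [::] (down l)).
  move=> /(_ (etrans (p_right _ _) _)); rewrite same_block_labels eqxx => /(_ erefl) e.
  etransitivity; [|etransitivity; [exact: e|]];
    by congr (f (_, _)); congr (_ _); try congr (_ _); apply: val_inj.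
(* [j] is read off the second middle column, the one shared by [r] and [s]. *)
pose j : labels n := [ffun l => Ordinal (flt (mid (inord 1) l))].
exists j; split=> a b.
- have E (c : point m [::] [:: White; Black]) :
      point_label (pair_index _ _ i j) (nil_index _) c =
      f (in_bot [:: White] (left_point [:: White] [:: White] (swap_point c))).
    case: c => [[[]//|[t tlt]] l]; rewrite /point_label /= ffunE.
    case: t tlt => [|[|//]] tlt /=; rewrite ?ffunE -?f0 /=;
    by congr (f (_, _)); congr (inl (inr _)); apply: val_inj; rewrite /= ?inordK.
  move=> ab; rewrite !E; apply/fb/(etrans (p_left _ _)); rewrite same_block_pinv.
  by case: a b ab => [[[]//|ka] la] [[[]//|kb] lb].
- have E (c : point m [::] [:: Black; White]) :
      point_label (pair_index _ _ j i) (nil_index _) c =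
      f (in_top [:: White] (right_point [:: White] [:: White] c)).
    case: c => [[[]//|[t tlt]] l]; rewrite /point_label /= ffunE.
    case: t tlt => [|[|//]] tlt /=; rewrite ?ffunE -?f2 /=;
    by congr (f (_, _)); congr (inl (inr _)); apply: val_inj; rewrite /= ?inordK.
  by move=> ab; rewrite !E; apply/ft/(etrans (q_right _ _)).
Qed.

(** The matrices of [r] and [s] have entries 0 and 1, so an entry of their product counts the [j]
    consistent with both. Diagonal counts are positive by [rigid_consistent_ex], the others vanish
    by [rigid_consistent_eq]. *)
Lemma rigid_part_op_inv (R : realType) :
  exists K, opcomp (fun i j => part_op R r (pair_index _ _ i j) (nil_index _)) K =
            opid (labels n).
Proof.
pose Rm := fun i j : labels n => part_op R r (pair_index _ _ i j) (nil_index _).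
pose Sm := fun i j : labels n => part_op R s (pair_index _ _ i j) (nil_index _).
have Rge i j : 0 <= Rm i j by rewrite ler0n.
have Sge i j : 0 <= Sm i j by rewrite ler0n.
have d0 k : opcomp Rm Sm k k != 0.
  rewrite /opcomp; have [j [h1 h2]] := rigid_consistent_ex k.
  rewrite psumr_neq0 => [|l _]; last exact: mulr_ge0.
  apply/hasP; exists j; rewrite ?mem_index_enum //=.
  by rewrite /Rm /Sm /part_op (introT (part_opP _ _ _) h1) (introT (part_opP _ _ _) h2) mulr1.
(* Dividing each column by its diagonal entry turns the diagonal product into the identity. *)
exists (fun j k => Sm j k / opcomp Rm Sm k k).
apply: amat_ext => i k; rewrite /opid /opcomp.
under eq_bigr do rewrite mulrA.
rewrite -mulr_suml; have [->|ik] := eqVneq i k; first exact: divff (d0 k).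
rewrite big1 ?mul0r // => j _; rewrite -/Rm /Rm /Sm /part_op -natrM mulnb.
case: andP => // -[/part_opP h1 /part_opP h2].
by case/eqP: ik; apply: rigid_consistent_eq h1 h2.
Qed.

End Rigid.

(** * Flattening *)

(** The factors need not commute, so the product is cut into consecutive runs of length [d] in
    order. *)
Lemma prod_ord_mul (V : pzRingType) M N d (F : 'I_M -> V) (G : 'I_N -> 'I_d -> V) :
  M = (N * d)%N ->
  (forall (s : 'I_M) (k : 'I_N) (e : 'I_d), s = (k * d + e)%N :> nat -> F s = G k e) ->
  \prod_s F s = \prod_k \prod_e G k e.
Proof.
move=> eM; subst M; elim: N F G => [|N IH] F G FG.
  by rewrite !big_ord0.
rewrite big_split_ord big_ord_recl /=; congr (_ * _).
  by apply: eq_bigr => e _; apply: FG.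
by apply: IH => s k e es; apply: FG; rewrite /= es /bump mulSn addnA.
Qed.

Section Flat.
Variables (m : nat) (z : word).
Hypothesis hz : (0 < size z)%N.

Lemma same_block_flat x y (q : spart (m * size z) x y) a b :
  same_block (flat q) (flat_point a) (flat_point b) = same_block q a b.
Proof.
apply/same_blockP/same_blockP => -[B Bq aB].
  case/imsetP: Bq aB => B' Bq' -> /andP[]; rewrite !mem_imset; try exact: flat_point_inj.
  by move=> aB bB; exists B'; rewrite ?aB.
exists [set flat_point c | c in B]; first exact: imset_f.
by rewrite !mem_imset //; exact: flat_point_inj.
Qed.

Lemma flat_bij x y : bijective (@flat m z x y).
Proof.
pose unflat (p : spart m (flat_word z x) (flat_word z y)) : spart (m * size z) x y :=
  part_of_labels (fun a => pblock p (flat_point a)).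
exists unflat => p; apply: same_block_ext => a b.
  by rewrite same_block_labels same_block_pblock same_block_flat.
have [g fg gf] := flat_point_bij m z x y.
by rewrite -(gf a) -(gf b) same_block_flat same_block_labels same_block_pblock.
Qed.

Lemma nth_flat_word (x : word) k e : (k < size x)%N -> (e < size z)%N ->
  nth White (flat_word z x) (k * size z + e) =
  nth White (if nth White x k is White then z else wbar z) e.
Proof.
move=> kx ez; elim: x k kx => [//|c x IH] k kx.
have sc : size (if c is White then z else wbar z) = size z.
  by case: c {IH kx} => //; rewrite /wbar size_rev size_map.
rewrite /flat_word /= nth_cat sc; case: k kx => [|k] kx; first by rewrite mul0n add0n ez.
rewrite mulSn -addnA ifN; last by rewrite -leqNgt leq_addr.
by rewrite addKn; apply: IH.
Qed.

Section Position.
Variable x : word.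

Lemma block_pos_subproof (k : 'I_(size x)) (c : 'I_(size z)) :
  (k * size z + (if letter k is White then c else rev_ord c) < size (flat_word z x))%N.
Proof.
rewrite size_flat_word; apply: (@leq_trans (k.+1 * size z)).
  by rewrite mulSn addnC ltn_add2r; case: (letter k).
by rewrite leq_mul2r ltn_ord orbT.
Qed.

(** Here [c] is an index into [z]; on a black block it is counted from the right end, in agreement
    with [offset]. *)
Definition block_pos k c : 'I_(size (flat_word z x)) := Ordinal (block_pos_subproof k c).

Lemma flat_posE (k : 'I_(size x)) (l : 'I_(m * size z)) :
  flat_pos k l = block_pos k (Ordinal (divl_subproof l)).
Proof.
apply: val_inj; rewrite /= /offset; congr (_ + _)%N.
by case: (letter k) => //=; rewrite -subn1 -subnDA add1n.
Qed.

Lemma block_pos_surj s : exists k c, s = block_pos k c.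
Proof.
have kx : (s %/ size z < size x)%N by rewrite ltn_divLR // -size_flat_word.
have ez : (s %% size z < size z)%N by rewrite ltn_mod.
pose k := Ordinal kx; pose e := Ordinal ez.
exists k, (if letter k is White then e else rev_ord e); apply: val_inj.
rewrite /= {1}(divn_eq s (size z)); congr (_ + _)%N; case: (letter k) => //.
exact: esym (congr1 val (rev_ordK e)).
Qed.

Lemma letter_flat (s : 'I_(size (flat_word z x))) (k : 'I_(size x)) (e : 'I_(size z)) :
  s = (k * size z + e)%N :> nat ->
  letter s = if letter k is White then letter e else flip (letter (rev_ord e)).
Proof.
move=> es; rewrite /letter !(tnth_nth White) /= es nth_flat_word //.
case: (nth White x k) => //.
by rewrite /wbar nth_rev size_map // (nth_map White) // ltn_subrL ltn0Sn.
Qed.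

Variable I : finType.

(* Identifies the basis of the [flat_word z x]-th power with that of the [x]-th
   power of the [z]-th power; [block_pos] reverses the order on black letters. *)
Definition regroup (g : multi I (flat_word z x)) : multi (multi I z) x :=
  [ffun k => [ffun c => g (block_pos k c)]].

Lemma regroup_bij : bijective regroup.
Proof.
apply: inj_card_bij => [g h e|].
  apply/ffunP => s; have [k [c ->]] := block_pos_surj s.
  by move/ffunP/(_ k): e; rewrite !ffunE => /ffunP/(_ c); rewrite !ffunE.
by rewrite !card_ffun !card_ord size_flat_word -expnM mulnC.
Qed.

(** On a black letter, [wbar z] reverses [z] and flips its colours; [arevprod] reverses the factors
    and exchanges [u] and [ub]. Both sides are therefore the same ordered product. *)
Lemma apow_regroup (R : realType) (A : cstarAlgType R) (u ub : amat A I) g h :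
  apow (apow u ub z) (arevprod (fun k => if letter k is White then ub else u)) x
    (regroup g) (regroup h) = apow u ub (flat_word z x) g h.
Proof.
symmetry; rewrite [RHS](eq_bigr (fun k : 'I_(size x) => \prod_(e < size z)
   (* [e] is the place inside the block of the flattened word, [c] the corresponding index into
      [z]. *)
   (let c := if letter k is White then e else rev_ord e in
    (if (if letter k is White then letter e else flip (letter (rev_ord e)))
        is White then u else ub) (g (block_pos k c)) (h (block_pos k c))))); last first.
  move=> k _; rewrite !ffunE; case ek: (letter k).
    by rewrite /apow; apply: eq_bigr => e _; rewrite !ffunE.
  rewrite /arevprod; apply: eq_bigr => e _; rewrite !ffunE.
  by case: (letter (rev_ord e)).
rewrite /apow; apply: prod_ord_mul; first exact: size_flat_word.
move=> s k e es /=; rewrite (letter_flat es).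
suff -> : block_pos k (if letter k is White then e else rev_ord e) = s by [].
apply: val_inj; rewrite /= es; congr (_ + _)%N; case: (letter k) => //.
by have := congr1 (@nat_of_ord _) (rev_ordK e).
Qed.

End Position.

Variable n : 'I_m -> nat.
Let L := labels (repeat_dims z n).

(** On basis vectors, the identification of the [z]-th power of [C^n] with [C^(n...n)]: level
    [j + c * m] carries the [j]-th label of factor [c]. *)
Definition merge_labels (i : multi (labels n) z) : L :=
  [ffun l => i (Ordinal (divl_subproof l)) (level l)].

Definition merge_multi x (i : multi (multi (labels n) z) x) : multi L x :=
  [ffun k => merge_labels (i k)].

Lemma merge_level_subproof (c : 'I_(size z)) (j : 'I_m) : (c * m + j < m * size z)%N.
Proof.
rewrite mulnC (@leq_trans (m * c.+1)) //; first by rewrite mulnS addnC ltn_add2r.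
by rewrite leq_mul2l ltn_ord orbT.
Qed.

Lemma merge_labels_bij : bijective merge_labels.
Proof.
pose l c j := Ordinal (merge_level_subproof c j).
have lj c j : level (l c j) = j.
  by apply: val_inj; rewrite /= modnMDl modn_small.
have lc c j : Ordinal (divl_subproof (l c j)) = c.
  have m0 : (0 < m)%N by apply: leq_ltn_trans (ltn_ord j).
  by apply: val_inj; rewrite /= divnMDl // divn_small // addn0.
have ll t : l (Ordinal (divl_subproof t)) (level t) = t.
  by apply: val_inj; rewrite /= -divn_eq.
(* The type of a label depends on its level, so labels at equal levels are compared as natural
   numbers. *)
have depE (f : L) s t : s = t -> f s = f t :> nat by move=> ->.
have depE' (f : labels n) s t : s = t -> f s = f t :> nat by move=> ->.
exists (fun f : L => [ffun c => [ffun j => cast_ord (congr1 n (lj c j)) (f (l c j))]]) => f.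
  apply/ffunP => c; apply/ffunP => j; apply: val_inj; rewrite !ffunE /= lc.
  exact: depE'.
apply/ffunP => t; apply: val_inj; rewrite !ffunE /=; exact: depE.
Qed.

(** Corresponding points under [flat_point] carry the same label, so constancy on blocks is the same
    condition for [q] and [flat q]. *)
Lemma part_op_flat (R : realType) x y (q : spart (m * size z) x y) g h :
  part_op R (flat q) g h =
  part_op R q (merge_multi (regroup g)) (merge_multi (regroup h)) :> R[i].
Proof.
have E a : point_label g h (flat_point a) =
    point_label (merge_multi (regroup g)) (merge_multi (regroup h)) a.
  by case: a => [[k|k] l]; rewrite /point_label /= !ffunE flat_posE.
rewrite /part_op; congr ((nat_of_bool _)%:R).
have [f _ fK] := flat_point_bij m z x y.
apply/(part_opP (flat q) g h)/(part_opP q _ _) => H a b; last first.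
  by rewrite -(fK a) -(fK b) same_block_flat !E; apply: H.
by rewrite -same_block_flat -!E; apply: H.
Qed.

End Flat.

(** * Tensor powers *)

Section Transport.
Variables (R : realType) (A : cstarAlgType R).

Lemma Hom_reindex (I J I' J' : finType) (f : I' -> I) (g : J' -> J)
    (u : amat A I) (v : amat A J) (T : op R J I) :
  bijective f -> bijective g ->
  Hom u v T <->
  Hom (fun i j => u (f i) (f j)) (fun i j => v (g i) (g j)) (fun j i => T (g j) (f i)).
Proof.
move=> bf bg; have [f' fK f'K] := bf; have [g' gK g'K] := bg.
split=> h i j.
  have := h (g i) (f j).
  by rewrite (reindex f) ?[in RHS](reindex g) //=; apply: onW_bij.
have := h (g' i) (f' j); rewrite g'K f'K => e.
by rewrite (reindex f) ?[in RHS](reindex g) //=; apply: onW_bij.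
Qed.

Lemma nil_indexE (I : finType) (i : multi I [::]) : i = nil_index I.
Proof. by apply/ffunP => -[]. Qed.

Lemma pair_index_bij (I : finType) c d :
  bijective (fun p : I * I => pair_index c d p.1 p.2).
Proof.
exists (fun g : multi I [:: c; d] => (g ord0, g ord_max)) => [[i j]|g] /=; first by rewrite !ffunE.
apply/ffunP => k; rewrite ffunE; case: eqP => [->//|k0]; congr (g _).
by apply: val_inj; case: k k0 => [[|[|//]] //= kl] []; apply: val_inj.
Qed.

(** Passes between words of length two, used for Hom spaces, and pairs of indices, used in the
    conjugate equations. *)
Lemma Hom_pairP (I : finType) (u ub : amat A I)
    (T : op R (multi I [:: White; Black]) (multi I [::])) :
  Hom (apow u ub [::]) (apow u ub [:: White; Black]) T <->
  Hom (@atriv R A) (atop u ub)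
    (fun a _ => T (pair_index _ _ a.1 a.2) (nil_index I)).
Proof.
have bn : bijective (fun _ : unit => nil_index I).
  by exists (fun=> tt) => [[]//|g]; rewrite [g]nil_indexE.
rewrite (Hom_reindex _ _ _ bn (@pair_index_bij I White Black)).
have -> : (fun i j : unit => apow u ub [::] (nil_index I) (nil_index I)) = @atriv R A.
  by apply: amat_ext => i j; rewrite /apow big_ord0.
have -> // : (fun i j : I * I => apow u ub [:: White; Black]
     (pair_index White Black i.1 i.2) (pair_index White Black j.1 j.2)) = atop u ub.
apply: amat_ext => i j.
by rewrite /apow !big_ord_recl big_ord0 mulr1 !ffunE.
Qed.

Lemma unitary_reindex (I J : finType) (f : I -> J) (u : amat A J) :
  bijective f -> is_unitary_amat u -> is_unitary_amat (fun i j => u (f i) (f j)).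
Proof.
move=> bf [h1 h2]; have fi := bij_inj bf; split=> i j.
  rewrite /aid -(inj_eq fi) -[RHS]h1 /amul [RHS](reindex f) //; exact: onW_bij.
rewrite /aid -(inj_eq fi) -[RHS]h2 /amul [RHS](reindex f) //; exact: onW_bij.
Qed.

Definition frev (I : finType) N (i : {ffun 'I_N -> I}) : {ffun 'I_N -> I} :=
  [ffun k => i (rev_ord k)].

Lemma frev_bij (I : finType) N : bijective (@frev I N).
Proof. by exists (@frev I N) => i; apply/ffunP => k; rewrite !ffunE rev_ordK. Qed.

(** Reversing multi-indices reduces the reversed product to an ordinary one, so unitarity and
    comultiplicativity carry over. *)
Lemma arevprodE (I : finType) N (v : 'I_N -> amat A I) :
  arevprod v = fun i j => aprod (fun k => v (rev_ord k)) (frev i) (frev j).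
Proof. by apply: amat_ext => i j; apply: eq_bigr => k _; rewrite !ffunE. Qed.

Lemma unitary_arevprod (I : finType) N (v : 'I_N -> amat A I) :
  (forall k, is_unitary_amat (v k)) -> is_unitary_amat (arevprod v).
Proof.
move=> hv; rewrite arevprodE; apply: unitary_reindex; first exact: frev_bij.
exact: unitary_aprod.
Qed.

End Transport.

Lemma comult_arevprod (R : realType) I J (G : qdata R I) N
    (v : 'I_N -> amat (qalg G) J) :
  is_cmqg G -> (forall k i j, qfun (v k i j)) ->
  (forall k, comultiplicative (v k)) -> comultiplicative (arevprod v).
Proof.
move=> hG hq hv i j; rewrite arevprodE.
have /(_ (frev i) (frev j)) -> :=
  comult_aprod hG (fun k => hq (rev_ord k)) (fun k => hv (rev_ord k)).
by rewrite (reindex (@frev J N)) //; apply/onW_bij/frev_bij.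
Qed.

(** * Operators permuting basis vectors *)

Section PermutationOperator.
Variables (R : realType) (I J : finType) (f : I -> J).

Definition perm_op : op R J I := fun j i => (j == f i)%:R.

Lemma perm_op_unitary : bijective f -> is_unitary_op perm_op.
Proof.
move=> bf; have [g fK gK] := bf; split=> i j; rewrite /opcomp /opadj /perm_op /opid.
  rewrite (bigD1 (f i)) //= eqxx rmorph1 mul1r (inj_eq (bij_inj bf)).
  by rewrite big1 ?addr0 // => k /negPf ->; rewrite rmorph_nat mul0r.
rewrite (bigD1 (g i)) //= gK eqxx mul1r rmorph_nat [j == i]eq_sym.
rewrite big1 ?addr0 // => k ki; suff /negPf -> : i != f k by rewrite mul0r.
by apply: contraNneq ki => ->; rewrite fK.
Qed.

Lemma oppow_perm x (j : multi J x) (i : multi I x) :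
  oppow perm_op x j i = (j == [ffun k => f (i k)])%:R.
Proof.
rewrite /oppow; have [->|ji] := eqVneq j.
  by apply: big1 => k _; rewrite /perm_op ffunE eqxx rmorph_nat; case: (letter k).
have [k jk] : exists k, j k != f (i k).
  apply/existsP; apply: contraNT ji => /existsPn h.
  by apply/eqP/ffunP => k; rewrite ffunE; apply/eqP/negPn/h.
by rewrite (bigD1 k) //= /perm_op (negPf jk) rmorph_nat; case: (letter k); rewrite mul0r.
Qed.

Lemma oppow_perm_adj x (j : multi J x) (i : multi I x) :
  oppow (opadj perm_op) x i j = (j == [ffun k => f (i k)])%:R.
Proof.
rewrite -oppow_perm; apply: eq_bigr => k _.
by rewrite /opadj /perm_op !rmorph_nat.
Qed.

Lemma opcomp_perm x y (S : op R (multi J y) (multi J x)) i j :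
  opcomp (oppow (opadj perm_op) y) (opcomp S (oppow perm_op x)) i j =
  S [ffun k => f (i k)] [ffun k => f (j k)].
Proof.
rewrite /opcomp (bigD1 [ffun k => f (i k)]) //= oppow_perm_adj eqxx mul1r.
rewrite [X in _ + X]big1 ?addr0 => [|a ai]; last by rewrite oppow_perm_adj (negPf ai) mul0r.
rewrite (bigD1 [ffun k => f (j k)]) //= oppow_perm eqxx mulr1.
by rewrite big1 ?addr0 // => a ai; rewrite oppow_perm (negPf ai) mulr0.
Qed.

End PermutationOperator.

(** * Comparison of the tensor power with the quantum group of the flattened category *)

Section Main.
Variables (R : realType) (m : nat) (n : 'I_m -> nat) (C : part_family m) (z : word).
Hypothesis hz : (0 < size z)%N.
Variables (G : qdata R (labels n)) (ub : amat (qalg G) (labels n)).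
Hypothesis hG : is_partition_qgroup C ub.
Variables (H : qdata R (labels (repeat_dims z n)))
    (wb : amat (qalg H) (labels (repeat_dims z n))).
Hypothesis hH : is_partition_qgroup (flat_preimage z C) wb.

Let u := qfund G.
Let U := apow u ub z.
Let Ub := arevprod (fun k : 'I_(size z) => if letter k is White then ub else u).

Lemma Hom_power_iff x y (T : op R _ _) :
  Hom (apow U Ub x) (apow U Ub y) T <->
  exists2 S, Hom (apow (qfund H) wb x) (apow (qfund H) wb y) S &
    forall i j, T i j = S (merge_multi i) (merge_multi j).
Proof.
case: hG => _ _ GC _; case: hH => _ _ HD _.
have bx := regroup_bij hz x (labels n); have by_ := regroup_bij hz y (labels n).
rewrite (Hom_reindex _ _ _ bx by_).
have E t : (fun i j => apow U Ub t (regroup i) (regroup j)) = apow u ub (flat_word z t).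
  by apply: amat_ext => i j; apply: apow_regroup.
rewrite !E GC; have [f' fK f'K] := flat_bij m z x y.
(* Reindexing by [flat] turns a combination over [C] into one over its flat preimage, with the same
   coefficients. *)
have sumE (c : spart (m * size z) x y -> R[i]) (g : multi (labels n) (flat_word z y)) h :
    \sum_(p in C (flat_word z x) (flat_word z y)) c (f' p) * part_op R p g h =
    \sum_(q in flat_preimage z C x y) c q *
        part_op R q (merge_multi (regroup g)) (merge_multi (regroup h)).
  rewrite (reindex (@flat m z x y)) /=; last by apply: onW_bij; exists f'.
  by apply: eq_big => [q|q _]; rewrite ?inE // fK part_op_flat.
split=> [[c cT]|[S /HD[c cS] TS]].
  exists (fun i j => \sum_(q in flat_preimage z C x y) c (flat q) * part_op R q i j).
    by apply/HD; exists (fun q => c (flat q)).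
  have [gx _ gxK] := bx; have [gy _ gyK] := by_.
  move=> i j; rewrite -(gyK i) -(gxK j) cT -(sumE (fun q => c (flat q))).
  by apply: eq_bigr => p _; rewrite f'K.
by exists (fun p => c (f' p)) => g h; rewrite TS cS sumE.
Qed.

Hypotheses (hC : is_category C) (hrigid : is_rigid C) (hgraded : is_graded n C).

Lemma fund_similar : similar_to_conj u ub.
Proof.
case: hG => -[_ uU _ _ _] _ GC _.
case: hC => _ CT Ci CW _.
case: hrigid => r [s [rC sC rs _]].
have gp := hgraded (CT _ _ _ _ _ _ (Ci _ _ _ rC) CW).
have gq := hgraded (CT _ _ _ _ _ _ CW sC).
have [K RK] := rigid_part_op_inv rs gp gq R.
have hr : Hom (apow u ub [::]) (apow u ub [:: White; Black]) (part_op R r).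
  (* The indicator of [r] as coefficients exhibits the operator of [r] in the span. *)
  apply/GC; exists (fun p => (p == r)%:R) => i j; rewrite (bigD1 r) //= eqxx mul1r.
  by rewrite big1 ?addr0 // => p /andP[_ /negPf ->]; rewrite mul0r.
move/Hom_pairP: hr => hr.
exists (optr (fun i j => part_op R r (pair_index _ _ i j) (nil_index _))), (optr K).
split; last exact: (Hom_triv_similar uU RK hr).
  by rewrite opcomp_tr (opcomp_inv_sym RK) optr_id.
by rewrite opcomp_tr RK optr_id.
Qed.

Lemma u_in i j : qfun (u i j).
Proof. by move=> S _; apply; exists i, j. Qed.

Let G_z := qpower ub z.

Lemma power_similar : similar_to_conj U Ub.
Proof.
apply: (@similar_to_conj_aprod _ _ _ _ (fun k => if letter k is White then u else ub)) => k.
(* At a black letter of [z] the factor is [ub] and its conjugate is [u], hence the symmetry. *)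
by case: (letter k); [|apply: similar_to_conj_sym]; apply: fund_similar.
Qed.

Lemma power_unitary : is_unitary_amat U.
Proof.
case: hG => -[_ uU _ _ _] [_ ubU] _ _.
by apply: (@unitary_aprod _ _ _ _ (fun k => if letter k is White then u else ub)) => k;
  case: (letter k).
Qed.

Lemma power_conj_unitary : is_unitary_amat Ub.
Proof.
case: hG => -[_ uU _ _ _] [_ ubU] _ _.
by apply: unitary_arevprod => k; case: (letter k).
Qed.

(** Allows the comultiplication of [G] to be restricted to the algebra of the tensor power. *)
Lemma power_fun_sub a : @qfun R _ G_z a -> @qfun R _ G a.
Proof.
apply; first exact: cstar_gen_subalg.
move=> b [i [j ->]]; apply: subalg_prod; first by case: (cstar_gen_subalg (@qentry R _ G)).
case: hG => _ [[hub _ _] _] _ _ k.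
by case: (letter k); [apply: u_in | apply: hub].
Qed.

Lemma power_subalg : is_star_subalg (@qfun R _ G_z).
Proof. by case: (cstar_gen_subalg (@qentry R _ G_z)). Qed.

Lemma power_in i j : @qfun R _ G_z (U i j).
Proof. by move=> S _; apply; exists i, j. Qed.

Lemma power_cmqg : is_cmqg G_z.
Proof.
case: hG => hc [[hub _ cub] _] _ _; case: (hc) => tG uU _ hd cu.
split=> //.
- exact: power_unitary.
- by have inv := similar_to_conj_inv power_subalg power_similar power_conj_unitary power_in.
- case: hd => d1 dD dM dZ dS; split=> // [a b /power_fun_sub ha /power_fun_sub hb|
    a b /power_fun_sub ha /power_fun_sub hb|c a /power_fun_sub ha|a /power_fun_sub ha].
  + exact: dD.
  + exact: dM.
  + exact: dZ.
  + exact: dS.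
- by apply: (comult_aprod (v := fun k => if letter k is White then u else ub) hc) => k;
    case: (letter k) => //; apply: u_in.
Qed.

(** [Ub] is built from entries of [u] and [ub], which are not known to lie in the algebra of the
    power; that its own entries do follows from its similarity to the conjugate of [U]. *)
Lemma power_conj_rep : @is_unitary_rep R _ _ G_z Ub.
Proof.
case: hG => hc [[hub _ cub] _] _ _; case: (hc) => tG uU _ hd cu.
have hq := similar_to_conj_in power_subalg power_similar power_in.
split; last exact: power_conj_unitary.
split=> //.
  by apply: unitary_invertible_in => //; [exact: power_subalg | exact: power_conj_unitary].
apply: (comult_arevprod hc) => k; case: (letter k) => //; exact: u_in.
Qed.

(** The morphism from 1 to [U (x) Ub] given by [power_similar] is carried to [H] by [Hom_power_iff].
    Its matrix there is a relabelled transpose of [F], hence invertible, and [Hom_triv_similar]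
    applies. *)
Lemma flat_similar : similar_to_conj (qfund H) wb.
Proof.
have [F [K [FK KF e]]] := power_similar.
have := similar_Hom_triv power_unitary FK e.
pose T : op R (multi (multi (labels n) z) [:: White; Black]) (multi (multi (labels n) z) [::]) :=
  fun g _ => F (g ord_max) (g ord0).
have -> : (fun a _ => F a.2 a.1) = (fun a (_ : unit) => T (pair_index _ _ a.1 a.2) (nil_index _)).
  by apply: funext => -[i j]; apply: funext => t; rewrite /T !ffunE.
move=> /Hom_pairP/Hom_power_iff[S /Hom_pairP hS TS].
case: hH => -[_ wU _ _ _] _ _ _.
have [g fK gK] := merge_labels_bij z n.
pose M := fun a b => S (pair_index White Black a b) (nil_index _).
have ME i j : M (merge_labels i) (merge_labels j) = F j i.
  have := TS (pair_index _ _ i j) (nil_index _); rewrite /T !ffunE /= => ->.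
  rewrite /M (nil_indexE (merge_multi _)); congr (S _ _).
  by apply/ffunP => k; rewrite !ffunE; case: ifP.
have MK : opcomp M (fun a b => K (g b) (g a)) = opid _.
  apply: amat_ext => a b; rewrite /opcomp (reindex (@merge_labels m z n)) /=; last first.
    by apply: onW_bij; exists g.
  transitivity (opcomp K F (g b) (g a)).
    by apply: eq_bigr => i _; rewrite fK -{1}(gK a) ME mulrC.
  by rewrite KF /opid (can_eq gK) eq_sym.
exists (optr M), (optr (fun a b => K (g b) (g a))).
split; last exact: (Hom_triv_similar wU MK hS).
  by rewrite opcomp_tr (opcomp_inv_sym MK) optr_id.
by rewrite opcomp_tr MK optr_id.
Qed.

End Main.

Theorem theorem5p6 (R : realType) (m : nat) (hm : (0 < m)%N) (n : 'I_m -> nat)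
    (C : part_family m) (hC : is_category C) (hrigid : is_rigid C)
    (hgraded : is_graded n C)
    (z : word) (hz : (0 < size z)%N)
    (G : qdata R (labels n)) (ub : amat (qalg G) (labels n))
    (hG : is_partition_qgroup C ub)
    (H : qdata R (labels (repeat_dims z n)))
    (wb : amat (qalg H) (labels (repeat_dims z n)))
    (hH : is_partition_qgroup (flat_preimage z C) wb) :
  equivalent (qpower ub z) H.
Proof.
have [Hc [Hwb wbU] _ _] := hH; have [_ wU _ _ _] := Hc.
split=> //; first exact: power_cmqg hG hC hrigid hgraded.
exists (arevprod (fun k => if letter k is White then ub else qfund G)), wb; split=> //.
- exact: power_conj_rep hG hC hrigid hgraded.
- apply: similar_conjugate.
  + exact: power_unitary hG.
  + exact: power_conj_unitary hG.
  + exact: power_similar hG hC hrigid hgraded.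
- exact: similar_conjugate wU wbU (flat_similar hz hG hH hC hrigid hgraded).
(* Conjugating by powers of this permutation relabels multi-indices by [merge_multi], which is the
   correspondence of [Hom_power_iff]. *)
exists (perm_op R (@merge_labels m z n)); split.
  exact/perm_op_unitary/merge_labels_bij.
move=> x y T; rewrite (Hom_power_iff hz hG hH).
by split=> -[S hS TS]; exists S => // i j; rewrite TS opcomp_perm.
Qed.
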